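(* Let $f:\mathbb{R}^n\to\mathbb{R}$, $g:\mathbb{R}^n\to\mathbb{R}^m$, $h:\mathbb{R}^n\to\mathbb{R}^p$ be continuously differentiable, let $\kappa<n$ be an integer, and assume that $g$ and $h$ are semialgebraic. Let $(x^*,y^* )$ be an accumulation point of a sequence $\{(x^k,y^k)\}$ generated by the safeguarded augmented Lagrangian method (SALM), and suppose that $(x^*,y^* )$ is feasible for the relaxation problem. Then $x^*$ is a CC-PAM-stationary point.
   Context: CCOP is the problem $\min f(x)$ s.t. $g(x)\le0$, $h(x)=0$, $\|x\|_0\le\kappa$, where $\|x\|_0$ is the number of nonzero components of $x$. Its relaxation problem is $\min_{(x,y)} f(x)$ s.t. $g(x)\le 0$, $h(x)=0$, $x\circ y=0$, $n-\kappa-e^Ty\le0$, $y\le e$, where $e=(1,\dots,1)^T\in\mathbb{R}^n$ and $\circ$ is the componentwise product (if $(x,y)$ is feasible for it, $x$ is feasible for CCOP). $\nabla g(x)$, $\nabla h(x)$ have columns $\nabla g_i(x)$, $\nabla h_j(x)$. $I_g(x)=\{i:g_i(x)=0\}$, $I_\pm(x)=\{\imath:x_\imath\neq0\}$; $(\cdot)_+=\max\{\cdot,0\}$ and $\min$ of vectors are taken componentwise. A map is semialgebraic if its graph is a semialgebraic set (a finite union of sets defined by finitely many polynomial equalities and strict inequalities). Augmented Lagrangian: for $\Lambda=(\lambda,\mu,\gamma,\delta,\eta)\in\mathbb{R}^m_+\times\mathbb{R}^p\times\mathbb{R}^n\times\mathbb{R}_+\times\mathbb{R}^n_+$, $\rho>0$,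 $$\mathscr{L}(x,y,\Lambda,\rho)=f(x)+\tfrac{\rho}{2}\Big[\|(g(x)+\tfrac{\lambda}{\rho})_+\|^2+\|h(x)+\tfrac{\mu}{\rho}\|^2+\|x\circ y+\tfrac{\gamma}{\rho}\|^2+\|(n-\kappa-e^Ty+\tfrac{\delta}{\rho})_+\|^2+\|(y-e+\tfrac{\eta}{\rho})_+\|^2\Big].$$ SALM: Step 1: given $(x^0,y^0)$, $\lambda_{max}>0$, $\mu_{min}<\mu_{max}$, $\gamma_{min}<\gamma_{max}$, $\delta_{max}>0$, $\eta_{max}>0$, $\tau>1$, $\sigma>1$, $\{\epsilon_k\}\subset\mathbb{R}_+$ with $\epsilon_k\downarrow0$; choose $\bar\Lambda^0=(\bar\lambda^0,\bar\mu^0,\bar\gamma^0,\bar\delta^0,\bar\eta^0)\in[0,\lambda_{max}]^m\times[\mu_{min},\mu_{max}]^p\times[\gamma_{min},\gamma_{max}]^n\times[0,\delta_{max}]\times[0,\eta_{max}]^n$, $\rho_0>0$, and set $k=1$. Step 2: compute $(x^k,y^k)$ with $\|\nabla_{(x,y)}\mathscr{L}(x^k,y^k,\bar\Lambda^{k-1},\rho_{k-1})\|\le\epsilon_k$. Step 3: set $\lambda^k=(\rho_{k-1}g(x^k)+\bar\lambda^{k-1})_+$, $\mu^k=\rho_{k-1}h(x^k)+\bar\mu^{k-1}$, $\gamma^k=\rho_{k-1}x^k\circ y^k+\bar\gamma^{k-1}$, $\eta^k=(\rho_{k-1}(y^k-e)+\bar\eta^{k-1})_+$, $\delta^k=(\rho_{k-1}(n-\kappa-e^Ty^k)+\bar\delta^{k-1})_+$.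 Step 4: let $U^k=\min\{-g(x^k),\bar\lambda^{k-1}/\rho_{k-1}\}$, $V^k=\min\{-(n-\kappa-e^Ty^k),\bar\delta^{k-1}/\rho_{k-1}\}$, $R^k=\min\{-(y^k-e),\bar\eta^{k-1}/\rho_{k-1}\}$. If $k=1$ or $\max\{\|U^{k-1}\|,\|h(x^{k-1})\|,\|x^{k-1}\circ y^{k-1}\|,\|V^{k-1}\|,\|R^{k-1}\|\}\ge\tau\max\{\|U^k\|,\|h(x^k)\|,\|x^k\circ y^k\|,\|V^k\|,\|R^k\|\}$, set $\rho_k=\rho_{k-1}$; otherwise set $\rho_k=\sigma\rho_{k-1}$. Step 5: choose any $\bar\Lambda^k=(\bar\lambda^k,\bar\mu^k,\bar\gamma^k,\bar\delta^k,\bar\eta^k)$ in the same box as $\bar\Lambda^0$; set $k\leftarrow k+1$ and go to Step 2. (No stopping criterion is used: the method generates an infinite sequence.) CC-PAM-stationary: a point $x^*$ feasible for CCOP is CC-PAM-stationary if there is a sequence $\{(x^k,\lambda^k,\mu^k,\gamma^k)\}\subset\mathbb{R}^n\times\mathbb{R}^m_+\times\mathbb{R}^p\times\mathbb{R}^n$ (not necessarily the one produced by SALM) such that, with $\pi_k=\|(1,\lambda^k,\mu^k,\gamma^k)\|_\infty$, for all sufficiently large $k$: (a) $x^k\to x^*$ and $\nabla f(x^k)+\nabla g(x^k)\lambda^k+\nabla h(x^k)\mu^k+\gamma^k\to 0$; (b) $\lambda_i^k=0$ for all $i\notin I_g(x^* )$, and $\gamma_\imath^k=0$ for all $\imath\in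 I_\pm(x^* )$; (c) $\lambda_i^k g_i(x^k)>0$ for every $i$ with $\lim_k \lambda_i^k/\pi_k>0$; (d) $\mu_j^k h_j(x^k)>0$ for every $j$ with $\lim_k|\mu_j^k|/\pi_k>0$; (e) $\gamma_\imath^k x_\imath^k>0$ for every $\imath$ with $\lim_k|\gamma_\imath^k|/\pi_k>0$. The bounded sequence $(\lambda^k,\mu^k,\gamma^k)/\pi_k$ is understood to converge (after passing to a subsequence), so that the limits in (c)-(e) exist. *)

(* Defs.v *)
From HB Require Import structures.
From mathcomp Require Import all_boot all_order all_algebra.
From mathcomp Require Import all_classical all_reals all_analysis.
(* Not imported: the notations of [mpoly] clash with those of MathComp-Analysis. *)
From mathcomp Require mpoly.

Set Implicit Arguments.
Unset Strict Implicit.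
Unset Printing Implicit Defensive.

Import Order.TTheory GRing.Theory Num.Theory.
Import numFieldNormedType.Exports.

Local Open Scope classical_set_scope.
Local Open Scope ring_scope.

(* Vectors of R^n are column matrices. The library norm `|v| on matrices (and on
   pairs) is the sup norm; the Euclidean norm is [enorm]. *)

Section EuclideanSpace.
Context {R : realType}.

Definition sqnorm n (v : 'cV[R]_n) : R := \sum_i v i 0 ^+ 2.

Definition enorm n (v : 'cV[R]_n) : R := Num.sqrt (sqnorm v).

Definition pos_part (t : R) : R := Num.max t 0.

Definition vpos n (v : 'cV[R]_n) : 'cV[R]_n := map_mx pos_part v.

Definition vmin n (u v : 'cV[R]_n) : 'cV[R]_n := map2_mx Num.min u v.

Definition hadamard n (u v : 'cV[R]_n) : 'cV[R]_n := map2_mx *%R u v.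

Definition l0norm n (v : 'cV[R]_n) : nat := #|[set i | v i 0 != 0]%SET|.

Definition grad n (F : 'cV[R]_n -> R) (x : 'cV[R]_n) : 'cV[R]_n :=
  \col_i 'D_(delta_mx i 0) F x.

(* The j-th column is the gradient of the j-th component. *)
Definition grads n m (G : 'cV[R]_n -> 'cV[R]_m) (x : 'cV[R]_n) : 'M[R]_(n, m) :=
  \matrix_(i, j) grad (fun z => G z j 0) x i 0.

(* In finite dimension, x |-> 'd F x is continuous iff it is so pointwise. *)
Definition continuously_differentiable (V W : normedModType R) (F : V -> W) :=
  (forall x, differentiable F x) /\
  (forall v, continuous (fun x => 'D_v F x)).

(* A pair (E, S) of lists of polynomials encodes the system P = 0 for P in E,
   Q > 0 for Q in S. *)
Definition polynomial_system N := (seq (mpoly.mpoly N R) * seq (mpoly.mpoly N R))%type.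

Definition solves N (z : 'cV[R]_N) (b : polynomial_system N) : bool :=
  all (fun P => mpoly.meval (fun i => z i 0) P == 0) b.1 &&
  all (fun Q => 0 < mpoly.meval (fun i => z i 0) Q) b.2.

Definition semialgebraic_set N (A : set 'cV[R]_N) : Prop :=
  exists s : seq (polynomial_system N), A = [set z | has (solves z) s].

Definition semialgebraic n m (G : 'cV[R]_n -> 'cV[R]_m) : Prop :=
  semialgebraic_set (range (fun x => col_mx x (G x))).

End EuclideanSpace.

Section CCOP.
Context {R : realType} {n m p : nat}.
Variables (f : 'cV[R]_n -> R) (g : 'cV[R]_n -> 'cV[R]_m)
  (h : 'cV[R]_n -> 'cV[R]_p) (kappa : int).

Definition ccop_feasible (x : 'cV[R]_n) : Prop :=
  [/\ forall i, g x i 0 <= 0, h x = 0 & (l0norm x)%:Z <= kappa].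

(* n - kappa - e^T y *)
Definition card_gap (y : 'cV[R]_n) : R :=
  n%:R - kappa%:~R - \sum_i y i 0.

Definition relaxation_feasible (x y : 'cV[R]_n) : Prop :=
  [/\ forall i, g x i 0 <= 0, h x = 0, hadamard x y = 0,
      card_gap y <= 0 & forall i, y i 0 <= 1].

Record multipliers := Multipliers {
  mult_lam : 'cV[R]_m;
  mult_mu : 'cV[R]_p;
  mult_gam : 'cV[R]_n;
  mult_del : R;
  mult_eta : 'cV[R]_n }.

Definition aug_lagrangian (x y : 'cV[R]_n) (L : multipliers) (rho : R) : R :=
  f x + rho / 2 *
    (sqnorm (vpos (g x + rho^-1 *: mult_lam L))
     + sqnorm (h x + rho^-1 *: mult_mu L)
     + sqnorm (hadamard x y + rho^-1 *: mult_gam L)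
     + pos_part (card_gap y + mult_del L / rho) ^+ 2
     + sqnorm (vpos (y - const_mx 1 + rho^-1 *: mult_eta L))).

(* The gradient with respect to the joint variable (x, y) in R^(n+n). *)
Definition grad_aug_lagrangian (x y : 'cV[R]_n) (L : multipliers) (rho : R) :
    'cV[R]_(n + n) :=
  grad (fun z : 'cV[R]_(n + n) =>
          aug_lagrangian (usubmx z) (dsubmx z) L rho) (col_mx x y).

Record salm_params := SalmParams {
  lam_max : R;
  mu_min : R;
  mu_max : R;
  gam_min : R;
  gam_max : R;
  del_max : R;
  eta_max : R;
  salm_tau : R;
  salm_sigma : R;
  salm_eps : nat -> R }.

Record salm_params_valid (P : salm_params) : Prop := {
  lam_max_gt0 : 0 < lam_max P;
  mu_min_max : mu_min P < mu_max P;
  gam_min_max : gam_min P < gam_max P;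
  del_max_gt0 : 0 < del_max P;
  eta_max_gt0 : 0 < eta_max P;
  tau_gt1 : 1 < salm_tau P;
  sigma_gt1 : 1 < salm_sigma P;
  eps_ge0 : forall k, 0 <= salm_eps P k;
  eps_nonincreasing : nonincreasing_seq (salm_eps P);
  eps_cvg0 : salm_eps P @ \oo --> (0 : R) }.

Definition in_box (P : salm_params) (L : multipliers) : Prop :=
  [/\ forall i, 0 <= mult_lam L i 0 <= lam_max P,
      forall j, mu_min P <= mult_mu L j 0 <= mu_max P,
      forall i, gam_min P <= mult_gam L i 0 <= gam_max P,
      0 <= mult_del L <= del_max P
    & forall i, 0 <= mult_eta L i 0 <= eta_max P].

Definition multiplier_update (x y : 'cV[R]_n) (L : multipliers) (rho : R) :
    multipliers :=
  {| mult_lam := vpos (rho *: g x + mult_lam L);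
     mult_mu := rho *: h x + mult_mu L;
     mult_gam := rho *: hadamard x y + mult_gam L;
     mult_del := pos_part (rho * card_gap y + mult_del L);
     mult_eta := vpos (rho *: (y - const_mx 1) + mult_eta L) |}.

(* max {|U|, |h(x)|, |x o y|, |V|, |R|}, for the safeguarded multipliers L and
   the penalty rho used to compute (x, y). *)
Definition salm_residual (x y : 'cV[R]_n) (L : multipliers) (rho : R) : R :=
  Num.max (enorm (vmin (- g x) (rho^-1 *: mult_lam L)))
  (Num.max (enorm (h x))
  (Num.max (enorm (hadamard x y))
  (Num.max `|Num.min (- card_gap y) (mult_del L / rho)|
           (enorm (vmin (- (y - const_mx 1)) (rho^-1 *: mult_eta L)))))).

(* A run of the method; [Lbar] are the safeguarded multipliers and [L] the
   updated ones, with [L 0] unused. Iteration k + 1 of the method produces the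
   terms of index k + 1. *)
Record salm_run (P : salm_params) (x y : nat -> 'cV[R]_n)
    (Lbar L : nat -> multipliers) (rho : nat -> R) : Prop := {
  salm_params_ok : salm_params_valid P;
  salm_rho0 : 0 < rho 0%N;
  salm_box : forall k, in_box P (Lbar k);
  salm_approx_stationary : forall k,
    enorm (grad_aug_lagrangian (x k.+1) (y k.+1) (Lbar k) (rho k)) <= salm_eps P k.+1;
  salm_update : forall k,
    L k.+1 = multiplier_update (x k.+1) (y k.+1) (Lbar k) (rho k);
  salm_rho1 : rho 1%N = rho 0%N;
  salm_penalty : forall k,
    rho k.+2 =
      if salm_tau P * salm_residual (x k.+2) (y k.+2) (Lbar k.+1) (rho k.+1)
         <= salm_residual (x k.+1) (y k.+1) (Lbar k) (rho k)
      then rho k.+1 else salm_sigma P * rho k.+1 }.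

Definition generated_by_salm (x y : nat -> 'cV[R]_n) : Prop :=
  exists P Lbar L rho, salm_run P x y Lbar L rho.

(* [pi k] is the sup norm of (1, lam k, mu k, gam k). *)
Record cc_pam_sequence (xs : 'cV[R]_n) (x : nat -> 'cV[R]_n)
    (lam : nat -> 'cV[R]_m) (mu : nat -> 'cV[R]_p) (gam : nat -> 'cV[R]_n)
    (pi := fun k => `|(1 : R, lam k, mu k, gam k)|) : Prop := {
  pam_lam_ge0 : forall k i, 0 <= lam k i 0;
  pam_cvg : x @ \oo --> xs;
  pam_stationary :
    (fun k => grad f (x k) + grads g (x k) *m lam k + grads h (x k) *m mu k
              + gam k) @ \oo --> (0 : 'cV[R]_n);
  pam_lam_inactive : forall i, g xs i 0 != 0 -> \forall k \near \oo, lam k i 0 = 0;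
  pam_gam_support : forall i, xs i 0 != 0 -> \forall k \near \oo, gam k i 0 = 0;
  pam_lam_normalized : cvgn (fun k => (pi k)^-1 *: lam k);
  pam_mu_normalized : cvgn (fun k => (pi k)^-1 *: mu k);
  pam_gam_normalized : cvgn (fun k => (pi k)^-1 *: gam k);
  pam_lam_sign : forall i, 0 < limn (fun k => lam k i 0 / pi k) ->
    \forall k \near \oo, 0 < lam k i 0 * g (x k) i 0;
  pam_mu_sign : forall j, 0 < limn (fun k => `|mu k j 0| / pi k) ->
    \forall k \near \oo, 0 < mu k j 0 * h (x k) j 0;
  pam_gam_sign : forall i, 0 < limn (fun k => `|gam k i 0| / pi k) ->
    \forall k \near \oo, 0 < gam k i 0 * x k i 0 }.

Definition cc_pam_stationary (xs : 'cV[R]_n) : Prop :=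
  ccop_feasible xs /\ exists x lam mu gam, cc_pam_sequence xs x lam mu gam.

End CCOP.

(* Main.v *)
Require Import Defs.
From HB Require Import structures.
From mathcomp Require Import all_boot all_order all_algebra.
From mathcomp Require Import all_classical all_reals all_analysis.
From mathcomp Require Import ring lra.
From mathcomp Require mpoly ordered_qelim qe_rcf polyrcf.

Set Implicit Arguments.
Unset Strict Implicit.
Unset Printing Implicit Defensive.

Import Order.TTheory GRing.Theory Num.Theory.
Import numFieldNormedType.Exports.

Local Open Scope classical_set_scope.
Local Open Scope ring_scope.

(* Let psi be half the sum of the squared violations of the constraints of the
   relaxation problem. Along a subsequence z_k = (x^k, y^k) -> zs, the gradient of
   rho_k psi at z_k is bounded, since it differs from that of the augmented
   Lagrangian by terms in the safeguarded multipliers. Then rho_k psi(z_k) -> 0: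
   otherwise |grad psi| <= K psi at points arbitrarily close to zs, and
   semialgebraic choice gives a curve of such points that tends to zs, whose
   coordinates are monotone and continuous. Such a curve has finite length, so
   log psi is bounded below along it, against psi(zs) = 0.

   Where xs_i <> 0, the multiplier gamma_i y_i of x_i is
   rho (x_i y_i)^2 / x_i + bar gamma_i y_i, which therefore tends to 0 and can be
   replaced by 0. If the multipliers are unbounded along every subsequence, their
   signs are those of the constraints because the safeguarded part is negligible.
   If they are bounded along a subsequence, they have a limit satisfying the KKT
   conditions. By Caratheodory's reduction the gradients in its support can be
   taken linearly independent, and the sequence xs + d / (k + 1) works for a
   direction d along which every constraint of the support moves with the sign of
   its multiplier. *)

(** * Semialgebraic predicates and quantifier elimination *)

(** The obstacle is that the penalty parameter may grow at any rate compared with the feasibility of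
    the iterates, so approximate stationarity alone leaves the size of [rho psi] open. A weak
    inequality of Lojasiewicz type settles it: from [rho |grad psi| <= C] and [rho psi >= c] follows
    [|grad psi| <= (C / c) psi], a bound on the slope of [log psi]. The objective enters only
    through its gradient, which stays bounded, so it is enough that psi, built from [g] and [h], is
    semialgebraic. No derivative of the selected curve is taken: with monotone coordinates the
    length between two of its points is a sum of signed increments, and comparing psi with an
    exponential of that length replaces the integration of [log psi]. Quantifier elimination fixes
    the local behaviour of each coordinate, and countability arguments exclude extrema and jumps at
    every point of an interval. The multipliers split into two cases because an updated multiplier
    reveals the sign of its constraint only when it exceeds the safeguarded part; bounded
    multipliers may say nothing about signs, and the iterates are then replaced by another
    sequence. *)

Section Definable.
Context {R : realType}.
Implicit Types (e : seq R) (P Q : seq R -> Prop) (u v : seq R -> R).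

Inductive polynomial_fun : (seq R -> R) -> Prop :=
| poly_const c : polynomial_fun (fun=> c)
| poly_var i : polynomial_fun (fun e => e`_i)
| poly_add u v : polynomial_fun u -> polynomial_fun v ->
    polynomial_fun (fun e => u e + v e)
| poly_mul u v : polynomial_fun u -> polynomial_fun v ->
    polynomial_fun (fun e => u e * v e).

(* Environments are read with default value 0 beyond their end, and the variable
   bound by a quantifier is the head of the environment. Only quantifier-free
   formulas are taken as definable; quantifier elimination closes the class
   under [exists]. *)
Inductive definable : (seq R -> Prop) -> Prop :=
| def_gt0 u : polynomial_fun u -> definable (fun e => 0 < u e)
| def_and P Q : definable P -> definable Q -> definable (fun e => P e /\ Q e)
| def_not P : definable P -> definable (fun e => ~ P e).

Lemma def_ext P Q : definable P -> (forall e, P e <-> Q e) -> definable Q.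
Proof. by move=> dP PQ; rewrite (_ : Q = P)//; apply/funext => e; apply/propext; split=> /PQ. Qed.

Lemma poly_opp u : polynomial_fun u -> polynomial_fun (fun e => - u e).
Proof.
move=> pu; rewrite (_ : (fun e => _) = (fun e => -1 * u e)).
  by apply: poly_mul => //; exact: poly_const.
by apply/funext => e; rewrite mulN1r.
Qed.

Lemma poly_sub u v : polynomial_fun u -> polynomial_fun v ->
  polynomial_fun (fun e => u e - v e).
Proof. by move=> pu pv; apply: poly_add => //; exact: poly_opp. Qed.

Lemma poly_exp u k : polynomial_fun u -> polynomial_fun (fun e => u e ^+ k).
Proof.
move=> pu; elim: k => [|k IH]; first exact: poly_const.
by under eq_fun do rewrite exprS; exact: poly_mul.
Qed.

Lemma poly_sum I (r : seq I) (u : I -> seq R -> R) :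
  (forall i, polynomial_fun (u i)) -> polynomial_fun (fun e => \sum_(i <- r) u i e).
Proof.
move=> pu; elim: r => [|i r IH].
  by under eq_fun do rewrite big_nil; exact: poly_const.
by under eq_fun do rewrite big_cons; exact: poly_add.
Qed.

Lemma poly_prod I (r : seq I) (u : I -> seq R -> R) :
  (forall i, polynomial_fun (u i)) -> polynomial_fun (fun e => \prod_(i <- r) u i e).
Proof.
move=> pu; elim: r => [|i r IH].
  by under eq_fun do rewrite big_nil; exact: poly_const.
by under eq_fun do rewrite big_cons; exact: poly_mul.
Qed.

Lemma poly_comp u (s : seq R -> seq R) : polynomial_fun u ->
  (forall i, polynomial_fun (fun e => (s e)`_i)) -> polynomial_fun (fun e => u (s e)).
Proof.
move=> pu ps; elim: pu => [c|i|u' v _ IHu _ IHv|u' v _ IHu _ IHv] //.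
- exact: poly_const.
- exact: poly_add.
- exact: poly_mul.
Qed.

Lemma def_comp P (s : seq R -> seq R) : definable P ->
  (forall i, polynomial_fun (fun e => (s e)`_i)) -> definable (fun e => P (s e)).
Proof.
move=> dP ps; elim: dP => [u pu|P' Q _ IHP _ IHQ|P' _ IHP].
- by apply: (def_gt0 (u := fun e => u (s e))); exact: poly_comp.
- exact: (def_and IHP IHQ).
- exact: (def_not IHP).
Qed.

Lemma def_lt0 u v : polynomial_fun u -> polynomial_fun v ->
  definable (fun e => u e < v e).
Proof.
move=> pu pv; apply: (def_ext (def_gt0 (poly_sub pv pu))) => e.
by rewrite subr_gt0.
Qed.

Lemma def_le0 u v : polynomial_fun u -> polynomial_fun v ->
  definable (fun e => u e <= v e).
Proof.
move=> pu pv; apply: (def_ext (def_not (def_lt0 pv pu))) => e.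
by rewrite leNgt; split=> /negP.
Qed.

Lemma def_eq0 u v : polynomial_fun u -> polynomial_fun v ->
  definable (fun e => u e = v e).
Proof.
move=> pu pv; apply: (def_ext (def_and (def_le0 pu pv) (def_le0 pv pu))) => e.
by split=> [[uv vu]|->//]; apply/eqP; rewrite eq_le uv.
Qed.

Lemma def_true : definable (fun=> True).
Proof. by apply: (def_ext (def_gt0 (poly_const 1))) => e; rewrite ltr01. Qed.

Lemma def_cst (A : Prop) : definable (fun=> A).
Proof.
case: (pselect A) => a; first exact: def_ext def_true _.
exact: def_ext (def_not def_true) _.
Qed.

Lemma def_or P Q : definable P -> definable Q -> definable (fun e => P e \/ Q e).
Proof.
move=> dP dQ; apply: (def_ext (def_not (def_and (def_not dP) (def_not dQ)))) => e.
by rewrite not_andP !notE.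
Qed.

Lemma def_imp P Q : definable P -> definable Q -> definable (fun e => P e -> Q e).
Proof.
move=> dP dQ; apply: (def_ext (def_or (def_not dP) dQ)) => e.
by split=> [[nP /nP//|//]|PQ]; case: (pselect (P e)) => p; [right; exact: PQ|left].
Qed.

Lemma def_all (I : finType) (P : I -> seq R -> Prop) :
  (forall i, definable (P i)) -> definable (fun e => forall i, P i e).
Proof.
move=> dP.
suff dr (r : seq I) : definable (fun e => forall i, i \in r -> P i e).
  by apply: (def_ext (dr (enum I))) => e; split=> Pe i;
    [apply: Pe; rewrite mem_enum|move=> _].
elim: r => [|j r IH]; first by apply: (def_ext def_true).
apply: (def_ext (def_and (dP j) IH)) => e; split=> [[Pj Pr] i|Pe].
  by rewrite inE => /predU1P[->//|/Pr].
by split=> [|i ir]; apply: Pe; rewrite inE ?eqxx// ir orbT.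
Qed.

Lemma polynomial_fun_finite_support u : polynomial_fun u ->
  exists M, forall e e', (forall i, (i < M)%N -> e`_i = e'`_i) -> u e = u e'.
Proof.
elim=> [c|i|u' v _ [M uM] _ [N vN]|u' v _ [M uM] _ [N vN]].
- by exists 0%N.
- by exists i.+1 => e e'; exact.
- exists (maxn M N) => e e' ee'; congr (_ + _); [apply: uM|apply: vN] => i iM;
  by apply: ee'; rewrite leq_max iM ?orbT.
- exists (maxn M N) => e e' ee'; congr (_ * _); [apply: uM|apply: vN] => i iM;
  by apply: ee'; rewrite leq_max iM ?orbT.
Qed.

Lemma definable_finite_support P : definable P ->
  exists M, forall e e', (forall i, (i < M)%N -> e`_i = e'`_i) -> P e -> P e'.
Proof.
suff: definable P -> exists M, forall e e',
    (forall i, (i < M)%N -> e`_i = e'`_i) -> P e <-> P e'.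
  by move=> H /H[M PM]; exists M => e e' /PM[].
elim=> [u /polynomial_fun_finite_support[M uM]|P' Q _ [M PM] _ [N QN]|P' _ [M PM]].
- by exists M => e e' /uM ->.
- exists (maxn M N) => e e' ee'.
  have {}PM := PM e e'; have {}QN := QN e e'.
  rewrite PM ?QN// => i iM; apply: ee'; by rewrite leq_max iM ?orbT.
- by exists M => e e' /PM ->.
Qed.

Import ordered_qelim.

Lemma polynomial_fun_of_rterm (t : GRing.term R) :
  GRing.rterm t -> polynomial_fun (fun e => GRing.eval e t).
Proof.
elim: t => //=.
- by move=> i _; exact: poly_var.
- by move=> c _; exact: poly_const.
- by move=> c _; exact: poly_const.
- by move=> t IHt t' IHt' /andP[/IHt ? /IHt' ?]; exact: poly_add.
- by move=> t IHt /IHt; exact: poly_opp.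
- move=> t IHt k /IHt {}IHt; under eq_fun do rewrite -mulr_natr.
  by apply: poly_mul => //; exact: poly_const.
- by move=> t IHt t' IHt' /andP[/IHt ? /IHt' ?]; exact: poly_mul.
- by move=> t IHt k /IHt; exact: poly_exp.
Qed.

Lemma definable_of_qf (phi : ord.formula R) :
  ord.qf_form phi && ord.rformula phi -> definable (fun e => ord.holds e phi).
Proof.
elim: phi => //=.
- by move=> b _; exact: def_cst.
- by move=> t t' /andP[rt rt']; apply: def_eq0; exact: polynomial_fun_of_rterm.
- by move=> t t' /andP[rt rt']; apply: def_lt0; exact: polynomial_fun_of_rterm.
- by move=> t t' /andP[rt rt']; apply: def_le0; exact: polynomial_fun_of_rterm.
- by move=> A IHA B IHB; rewrite andbACA => /andP[/IHA ? /IHB ?]; exact: def_and.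
- by move=> A IHA B IHB; rewrite andbACA => /andP[/IHA ? /IHB ?]; exact: def_or.
- by move=> A IHA B IHB; rewrite andbACA => /andP[/IHA ? /IHB ?]; exact: def_imp.
- by move=> A IHA /IHA; exact: def_not.
Qed.

(** A [realType] is a real closed field, so quantifier elimination for such fields applies. Inverses
    are removed first by [to_rform], since only ring terms are translated back into polynomials. *)
Lemma definable_holds (phi : ord.formula R) : definable (fun e => ord.holds e phi).
Proof.
have rphi := ord.to_rform_rformula phi.
have qfphi := ord.quantifier_elim_wf (@qe_rcf.wf_QE_wproj R) rphi.
have [qf _] := andP qfphi.
apply: (def_ext (definable_of_qf qfphi)) => e.
rewrite (rwP (ord.qf_evalP e qf)) -ord.to_rformP; split.
  by move=> /(ord.quantifier_elim_rformP (@qe_rcf.wf_QE_wproj R) (@qe_rcf.valid_QE_wproj R) e rphi).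
by move=> /(ord.quantifier_elim_rformP (@qe_rcf.wf_QE_wproj R) (@qe_rcf.valid_QE_wproj R) e rphi).
Qed.

Lemma term_of_polynomial_fun u : polynomial_fun u ->
  exists t : GRing.term R, forall e, GRing.eval e t = u e.
Proof.
elim=> [c|i|u' v _ [t ut] _ [t' vt']|u' v _ [t ut] _ [t' vt']].
- by exists (GRing.Const c).
- by exists (GRing.Var _ i).
- by exists (GRing.Add t t') => e /=; rewrite ut vt'.
- by exists (GRing.Mul t t') => e /=; rewrite ut vt'.
Qed.

Lemma formula_of_definable P : definable P ->
  exists phi : ord.formula R, forall e, ord.holds e phi <-> P e.
Proof.
elim=> [u /term_of_polynomial_fun[t tu]|P' Q _ [A PA] _ [B QB]|P' _ [A PA]].
- by exists (ord.Lt (GRing.NatConst _ 0) t) => e /=; rewrite tu.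
- by exists (ord.And A B) => e /=; rewrite PA QB.
- by exists (ord.Not A) => e /=; rewrite PA.
Qed.

(* The library binds variables by position in the environment: the bound
   variable is moved to a slot [M] that [P] does not read. *)
Lemma def_ex_cons P : definable P -> definable (fun e => exists x, P (x :: e)).
Proof.
move=> dP; have [M PM] := definable_finite_support dP.
have dPs : definable (fun e => P (e`_M :: e)).
  by apply: def_comp => // -[|i] /=; exact: poly_var.
have [phi phiP] := formula_of_definable dPs.
apply: (def_ext (definable_holds (ord.Exists M phi))) => e /=.
have swap x i : (i < M)%N -> (x :: set_nth 0 e M x)`_i = (x :: e)`_i.
  case: i => [//|i] /ltnW iM /=; by rewrite nth_set_nth /= (ltn_eqF iM).
split=> [[x]|[x Px]]; [move=> /phiP|]; last (exists x; apply/phiP);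
  rewrite nth_set_nth /= eqxx.
- by move=> Px; exists x; apply: PM Px => i /swap.
- by apply: PM Px => i /swap.
Qed.

Lemma def_ex (Q : R -> seq R -> Prop) :
  definable (fun e => Q e`_0 (behead e)) -> definable (fun e => exists x, Q x e).
Proof. exact: def_ex_cons. Qed.

Lemma def_fa (Q : R -> seq R -> Prop) :
  definable (fun e => Q e`_0 (behead e)) -> definable (fun e => forall x, Q x e).
Proof.
move=> dQ; apply: (def_ext (def_not (@def_ex (fun x e => ~ Q x e) (def_not dQ)))) => e.
by split=> [H x|H [x]//]; apply: contrapT => nQ; apply: H; exists x.
Qed.

(** The value stands at the head of the environment, the place of a variable bound by a quantifier,
    so that a function can be substituted through an existential quantifier as in [def_let]. *)
Definition definable_fun u := definable (fun e => e`_0 = u (behead e)).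

Lemma poly_definable_fun u : polynomial_fun u -> definable_fun u.
Proof.
move=> pu; apply: def_eq0; first exact: poly_var.
by apply: poly_comp => // i; under eq_fun do rewrite nth_behead; exact: poly_var.
Qed.

Lemma dfun_const c : definable_fun (fun=> c).
Proof. exact/poly_definable_fun/poly_const. Qed.

Lemma dfun_var i : definable_fun (fun e => e`_i).
Proof. exact/poly_definable_fun/poly_var. Qed.

Lemma dfun_comp u (s : seq R -> seq R) : definable_fun u ->
  (forall i, polynomial_fun (fun e => (s e)`_i)) -> definable_fun (fun e => u (s e)).
Proof.
move=> du ps; apply: (def_comp (s := fun e => e`_0 :: s (behead e)) du) => -[|i] /=.
  exact: poly_var.
apply: (poly_comp (u := fun e => (s e)`_i)) => // j.
by under eq_fun do rewrite nth_behead; exact: poly_var.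
Qed.

Lemma poly_nth_behead i : polynomial_fun (fun e => (behead e)`_i).
Proof. by under eq_fun do rewrite nth_behead; exact: poly_var. Qed.

Lemma poly_nth_drop k i : polynomial_fun (fun e => (drop k e)`_i).
Proof. by under eq_fun do rewrite nth_drop; exact: poly_var. Qed.

Lemma dfun_behead u : definable_fun u -> definable_fun (fun e => u (behead e)).
Proof. by move=> du; apply: dfun_comp => // i; exact: poly_nth_behead. Qed.

Lemma dfun_drop k u : definable_fun u -> definable_fun (fun e => u (drop k e)).
Proof. by move=> du; apply: dfun_comp => // i; exact: poly_nth_drop. Qed.

Lemma def_behead P : definable P -> definable (fun e => P (behead e)).
Proof. by move=> dP; apply: def_comp => // i; exact: poly_nth_behead. Qed.

(** Substituting [u] amounts to asserting that some [x] equals [u e] and satisfies [Q]; quantifier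
    elimination thus gives closure under composition with functions that are not polynomial. *)
Lemma def_let u (Q : R -> seq R -> Prop) : definable_fun u ->
  definable (fun e => Q e`_0 (behead e)) -> definable (fun e => Q (u e) e).
Proof.
move=> du dQ; apply: (def_ext (@def_ex (fun x e => x = u e /\ Q x e) (def_and du dQ))) => e.
by split=> [[_ [->]]|Qu]//; exists (u e).
Qed.

Lemma def_let2 u v (Q : R -> R -> seq R -> Prop) :
  definable_fun u -> definable_fun v ->
  definable (fun e => Q e`_1 e`_0 (drop 2 e)) -> definable (fun e => Q (u e) (v e) e).
Proof.
move=> du dv dQ; apply: (@def_let u (fun a e => Q a (v e) e)) => //.
apply: (@def_let (fun e => v (behead e)) (fun b e => Q e`_0 b (behead e))).
  exact: dfun_behead.
by apply: (def_ext dQ) => e; rewrite nth_behead -!drop1 drop_drop.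
Qed.

Lemma def_lt u v : definable_fun u -> definable_fun v -> definable (fun e => u e < v e).
Proof.
move=> du dv; apply: (def_let2 (Q := fun a b _ => a < b)) => //.
by apply: def_lt0; exact: poly_var.
Qed.

Lemma def_le u v : definable_fun u -> definable_fun v -> definable (fun e => u e <= v e).
Proof.
move=> du dv; apply: (def_let2 (Q := fun a b _ => a <= b)) => //.
by apply: def_le0; exact: poly_var.
Qed.

Lemma def_eq u v : definable_fun u -> definable_fun v -> definable (fun e => u e = v e).
Proof.
move=> du dv; apply: (def_let2 (Q := fun a b _ => a = b)) => //.
by apply: def_eq0; exact: poly_var.
Qed.

Lemma dfun_let2 u v (w : R -> R -> R) :
  definable_fun u -> definable_fun v ->
  definable (fun e => e`_2 = w e`_1 e`_0) -> definable_fun (fun e => w (u e) (v e)).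
Proof.
move=> /dfun_behead du /dfun_behead dv dw.
apply: (def_let2 (Q := fun a b e => e`_0 = w a b) du dv).
by apply: (def_ext dw) => e; rewrite nth_drop.
Qed.

Lemma dfun_add u v : definable_fun u -> definable_fun v ->
  definable_fun (fun e => u e + v e).
Proof.
move=> du dv; apply: dfun_let2 => //; apply: def_eq0; first exact: poly_var.
by apply: poly_add; exact: poly_var.
Qed.

Lemma dfun_mul u v : definable_fun u -> definable_fun v ->
  definable_fun (fun e => u e * v e).
Proof.
move=> du dv; apply: dfun_let2 => //; apply: def_eq0; first exact: poly_var.
by apply: poly_mul; exact: poly_var.
Qed.

Lemma dfun_opp u : definable_fun u -> definable_fun (fun e => - u e).
Proof.
move=> du; under eq_fun do rewrite -mulN1r.
by apply: dfun_mul => //; exact: dfun_const.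
Qed.

Lemma dfun_sub u v : definable_fun u -> definable_fun v ->
  definable_fun (fun e => u e - v e).
Proof. by move=> du dv; apply: dfun_add => //; exact: dfun_opp. Qed.

Lemma dfun_max u v : definable_fun u -> definable_fun v ->
  definable_fun (fun e => Num.max (u e) (v e)).
Proof.
move=> du dv; apply: (dfun_let2 (w := Num.max)) => //.
have d20 : definable (fun e => e`_2 = e`_0) by apply: def_eq0; exact: poly_var.
have d21 : definable (fun e => e`_2 = e`_1) by apply: def_eq0; exact: poly_var.
have d10 : definable (fun e => e`_1 <= e`_0) by apply: def_le0; exact: poly_var.
apply: (def_ext (def_and (def_imp d10 d20) (def_imp (def_not d10) d21))) => e.
case: leP => [le10|lt01]; split.
- by case=> + _; exact.
- by move=> ->; split=> // /(_ isT).
- by case=> _; exact.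
- by move=> ->; split.
Qed.

Lemma dfun_abs u : definable_fun u -> definable_fun (fun e => `|u e|).
Proof.
move=> du; rewrite (_ : (fun e => _) = (fun e => Num.max (u e) (- u e))).
  by apply: dfun_max => //; exact: dfun_opp.
apply/funext => e; have [u0|/ltW u0] := leP 0 (u e).
  by rewrite ger0_norm// max_l//; lra.
by rewrite ler0_norm// max_r//; lra.
Qed.

Lemma dfun_sum I (r : seq I) (u : I -> seq R -> R) :
  (forall i, definable_fun (u i)) -> definable_fun (fun e => \sum_(i <- r) u i e).
Proof.
move=> pu; elim: r => [|i r IH].
  by under eq_fun do rewrite big_nil; exact: dfun_const.
by under eq_fun do rewrite big_cons; exact: dfun_add.
Qed.

Definition colseq N e : 'cV[R]_N := \col_i e`_i.

Lemma def_exseq N P : definable P ->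
  definable (fun e => exists w : seq R, size w = N /\ P (w ++ e)).
Proof.
elim: N P => [|N IH] P dP.
  by apply: (def_ext dP) => e; split=> [Pe|[w [/size0nil ->]]//]; exists [::].
apply: (def_ext (IH _ (def_ex_cons dP))) => e; split.
  by move=> [w [wN [x Px]]]; exists (x :: w); split=> //=; rewrite wN.
by move=> [[|x w] [//= [wN] Px]]; exists w; split=> //; exists x.
Qed.

Lemma def_exv N (Q : 'cV[R]_N -> seq R -> Prop) :
  definable (fun e => Q (colseq N e) (drop N e)) -> definable (fun e => exists w, Q w e).
Proof.
move=> dQ; apply: (def_ext (def_exseq N dQ)) => e; split.
  move=> [w [wN Qw]]; exists (colseq N w).
  rewrite drop_size_cat// in Qw; congr Q: Qw.
  by apply/matrixP => i j; rewrite !mxE nth_cat wN ltn_ord.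
move=> [w Qw]; exists [seq w i 0 | i <- enum 'I_N].
have sw : size [seq w i 0 | i <- enum 'I_N] = N by rewrite size_map size_enum_ord.
split=> //; rewrite drop_size_cat//; congr Q: Qw.
apply/matrixP => i j; rewrite !mxE nth_cat sw ltn_ord (nth_map i) ?size_enum_ord//.
by rewrite nth_ord_enum ord1.
Qed.

Lemma def_fav N (Q : 'cV[R]_N -> seq R -> Prop) :
  definable (fun e => Q (colseq N e) (drop N e)) -> definable (fun e => forall w, Q w e).
Proof.
move=> dQ; apply: (def_ext (def_not (@def_exv _ (fun x e => ~ Q x e) (def_not dQ)))) => e.
by split=> [H x|H [x]//]; apply: contrapT => nQ; apply: H; exists x.
Qed.

Lemma def_subst_col N (u : 'I_N -> seq R -> R) (Q : 'cV[R]_N -> seq R -> Prop) :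
  (forall i, definable_fun (u i)) ->
  definable (fun e => Q (colseq N e) (drop N e)) ->
  definable (fun e => Q (\col_i u i e) e).
Proof.
move=> du dQ.
apply: (def_ext (@def_exv _ (fun w e => (forall i, w i 0 = u i e) /\ Q w e) _)) => [|e].
  apply: def_and dQ; apply: def_all => i; apply: def_eq; last exact: dfun_drop.
  by under eq_fun do rewrite mxE; exact: dfun_var.
split=> [[w [wu]]|Qu]; last by exists (\col_i u i e); split=> // i; rewrite mxE.
by congr Q; apply/matrixP => i j; rewrite mxE ord1.
Qed.

Lemma poly_meval N (p : mpoly.mpoly N R) :
  polynomial_fun (fun e => mpoly.meval (fun i => colseq N e i 0) p).
Proof.
under eq_fun do rewrite mpoly.mevalE.
apply: poly_sum => m; apply: poly_mul; first exact: poly_const.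
apply: poly_prod => i; apply: poly_exp; under eq_fun do rewrite mxE.
exact: poly_var.
Qed.

Lemma semialgebraic_set_definable N (A : set 'cV[R]_N) : semialgebraic_set A ->
  definable (fun e => A (colseq N e)).
Proof.
move=> [s ->] /=; elim: s => [|b s IH] /=.
  by apply: (def_ext (def_cst False)).
have dE (l : seq (mpoly.mpoly N R)) : definable (fun e =>
    all (fun p => mpoly.meval (fun i => colseq N e i 0) p == 0) l).
  elim: l => [|p l IHl] /=; first by apply: (def_ext def_true).
  apply: (def_ext (def_and (def_eq0 (poly_meval p) (poly_const 0)) IHl)) => e.
  by split=> [[/eqP -> //]|/andP[/eqP]].
have dS (l : seq (mpoly.mpoly N R)) : definable (fun e =>
    all (fun p => 0 < mpoly.meval (fun i => colseq N e i 0) p) l).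
  elim: l => [|p l IHl] /=; first by apply: (def_ext def_true).
  apply: (def_ext (def_and (def_gt0 (poly_meval p)) IHl)) => e.
  by split=> [[-> //]|/andP[]].
apply: (def_ext (def_or (def_and (dE b.1) (dS b.2)) IH)) => e.
rewrite /solves; split=> [[[-> -> //]|->]|/orP[/andP[]|]]; rewrite ?orbT//; tauto.
Qed.

(** One component of [G] is obtained by projecting its graph: the whole vector [v = G x] is
    quantified existentially, and the head of the environment is compared with its entry [j]. *)
Lemma semialgebraic_definable n m (G : 'cV[R]_n -> 'cV[R]_m) j : semialgebraic G ->
  definable_fun (fun e => G (colseq n e) j 0).
Proof.
move=> /semialgebraic_set_definable dG.
(* Layout under the quantifier: [v] occupies the first [m] places, the candidate value has index
   [m], and the argument of [G] starts at index [m + 1]. *)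
pose u (i : 'I_(n + m)) (e : seq R) : R :=
  match fintype.split i with inl k => e`_(m + k.+1) | inr k => e`_k end.
have du i : definable_fun (u i) by rewrite /u; case: (fintype.split i) => k; exact: dfun_var.
have dgraph : definable (fun e =>
    range (fun x => col_mx x (G x)) (\col_i u i e)).
  apply: (def_subst_col du (Q := fun w _ => range (fun x => col_mx x (G x)) w)).
  exact: dG.
have colu e : \col_i u i e = col_mx (colseq n (drop m.+1 e)) (colseq m e).
  apply/matrixP => i k; rewrite !mxE /u; case: (fintype.split i) => l.
    by rewrite mxE nth_drop addSnnS.
  by rewrite mxE.
have dexv := @def_exv m (fun (v : 'cV[R]_m) e =>
   range (fun x => col_mx x (G x)) (col_mx (colseq n (behead e)) v) /\ e`_0 = v j 0).
apply: (def_ext (dexv _)) => [|e].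
  apply: def_and.
    apply: (def_ext dgraph) => e; rewrite colu.
    by rewrite -drop1 drop_drop.
  apply: def_eq; first exact: (dfun_drop m (dfun_var 0)).
  by under eq_fun do rewrite mxE; exact: dfun_var.
split=> [[v [[x _ /eq_col_mx[-> <-]]]]//|->].
by exists (G (colseq n (behead e))); split=> //; exists (colseq n (behead e)).
Qed.

End Definable.


Ltac solve_def := cbn beta; lazymatch goal with
| |- definable (fun e => _ /\ _) => apply: def_and; solve_def
| |- definable (fun e => _ \/ _) => apply: def_or; solve_def
| |- definable (fun e => ~ _) => apply: def_not; solve_def
| |- definable (fun e => exists x, _) => apply: def_ex; solve_def
(* An implication also matches this pattern, hence [def_imp] is tried before [def_fa]. *)
| |- definable (fun e => forall x, _) =>
    first [apply: def_imp | apply: def_fa]; solve_def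
| |- definable (fun e => is_true (_ < _)) => apply: def_lt; solve_def
| |- definable (fun e => is_true (_ <= _)) => apply: def_le; solve_def
| |- definable (fun e => _ = _) => apply: def_eq; solve_def
| |- definable_fun (fun _ => ?c) => exact: dfun_const
| |- definable_fun (fun e => nth _ _ _) =>
    apply: poly_definable_fun; (do ?under eq_fun do rewrite nth_behead); exact: poly_var
| |- definable_fun (fun e => _ + _) => apply: dfun_add; solve_def
| |- definable_fun (fun e => _ * _) => apply: dfun_mul; solve_def
| |- definable_fun (fun e => - _) => apply: dfun_opp; solve_def
| |- definable_fun (fun e => `|_|) => apply: dfun_abs; solve_def
| |- _ => idtac end.

(** * Definable functions of one variable *)

Section OneVariable.
Context {R : realType}.
Implicit Types (e : seq R) (P Q : seq R -> Prop) (u v : R -> R).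

Lemma polynomial_fun_head (w : seq R -> R) e : polynomial_fun w ->
  exists p : {poly R}, forall t, w (t :: e) = p.[t].
Proof.
elim=> [c|[|i]|w1 w2 _ [p pw] _ [q qw]|w1 w2 _ [p pw] _ [q qw]].
- by exists c%:P => t; rewrite hornerC.
- by exists 'X => t; rewrite hornerX.
- by exists (e`_i)%:P => t; rewrite hornerC.
- by exists (p + q) => t; rewrite hornerD pw qw.
- by exists (p * q) => t; rewrite hornerM pw qw.
Qed.

(** With the other variables frozen, an atomic formula is a sign condition on a polynomial in one
    variable, whose sign is constant between [a] and its next root. Boolean combinations keep the
    property, a conjunction on the smaller of two intervals. *)
Lemma definable_right_germ P e a : definable P -> exists2 r, 0 < r &
  (forall t, a < t -> t < a + r -> P (t :: e)) \/
  (forall t, a < t -> t < a + r -> ~ P (t :: e)).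
Proof.
elim=> [w /(polynomial_fun_head e)[p pw]|P' Q _ [r r0 Pr] _ [s s0 Qs]|P' _ [r r0 Pr]].
- have [p0|p0] := eqVneq p 0.
    by exists 1 => //; right => t _ _; rewrite pw p0 horner0 ltxx.
  have a1 : a < a + 1 by rewrite ltrDl.
  have gt_a := polyrcf.next_root_gt a1 p0.
  exists (polyrcf.next_root p a (a + 1) - a); first by rewrite subr_gt0.
  have sg t : a < t -> t < a + (polyrcf.next_root p a (a + 1) - a) ->
      Num.sg p.[t] = polyrcf.sgp_right p a.
    rewrite addrC subrK => at_ tn; apply: (@polyrcf.sgr_neighpr _ (a + 1)).
    by rewrite /polyrcf.neighpr in_itv /= at_.
  have [sp|sp] := eqVneq (polyrcf.sgp_right p a) 1; [left|right] => t ta tr;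
    rewrite pw -sgr_cp0 sg//; first [exact/eqP | exact/negP].
- exists (Num.min r s); first by rewrite lt_min r0.
  have lr t : t < a + Num.min r s -> t < a + r /\ t < a + s.
    by rewrite -ltrBlDl lt_min => /andP[]; rewrite !ltrBlDl.
  case: Pr => Pr; last by right => t ta /lr[tr ts] [Pt _]; exact: Pr Pt.
  case: Qs => Qs; last by right => t ta /lr[tr ts] [_ Qt]; exact: Qs Qt.
  by left => t ta /lr[tr ts]; split; [exact: Pr|exact: Qs].
- exists r => //; case: Pr => Pr; [right|left] => t ta tr; last exact: Pr.
  by move=> /(_ (Pr _ ta tr)).
Qed.

Lemma right_germ (S : R -> Prop) a : definable (fun e => S e`_0) ->
  exists2 r, 0 < r &
  (forall t, a < t -> t < a + r -> S t) \/ (forall t, a < t -> t < a + r -> ~ S t).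
Proof. by move=> /(definable_right_germ [::] a). Qed.

Lemma right_germ0 (S : R -> Prop) : definable (fun e => S e`_0) ->
  exists2 r, 0 < r &
  (forall t, 0 < t -> t < r -> S t) \/ (forall t, 0 < t -> t < r -> ~ S t).
Proof.
by move=> /(right_germ 0)[r r0]; rewrite add0r => rS; exists r.
Qed.

Lemma dfun_comp1 u (w : seq R -> R) : definable_fun (fun e => u e`_0) ->
  definable_fun w -> definable_fun (fun e => u (w e)).
Proof.
move=> du dw.
apply: (@def_let _ (fun e => w (behead e)) (fun a e => e`_0 = u a)).
  exact: dfun_behead.
apply: def_eq; last exact: du.
exact: (dfun_behead (dfun_var 0)).
Qed.

(** Real induction. The radius depends on the point without a uniform lower bound, so finitely many
    steps of fixed length would not do; instead the supremum of the points reached from [s] is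
    itself reached from its left, and can be passed on its right unless it equals [t]. *)
Lemma transitive_local_global (Rel : R -> R -> Prop) a b :
  (forall x y z, Rel x y -> Rel y z -> Rel x z) ->
  (forall t, a < t -> t < b -> exists2 r, 0 < r &
     (forall s, a < s -> t - r < s -> s < t -> Rel s t) /\
     (forall s, s < b -> t < s -> s < t + r -> Rel t s)) ->
  forall s t, a < s -> s < t -> t < b -> Rel s t.
Proof.
move=> tr loc s t as_ st tb.
pose E := [set x | [/\ s < x, x <= t & forall y, s < y -> y <= x -> Rel s y]].
have [r r0 [_ rs]] := loc s as_ (lt_trans st tb).
have supE : has_sup E.
  split; last by exists t => x [].
  exists (Num.min t (s + r / 2)); split.
  - by rewrite lt_min st /=; lra.
  - by rewrite ge_min lexx.
  - by move=> y sy; rewrite le_min => /andP[yt ysr]; apply: rs => //; lra.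
have sE x : E x -> s < x <= sup E.
  by move=> Ex; case: (Ex) => -> _ _ /=; exact: (ub_le_sup supE.2).
have sc : s < sup E by have [x /sE/andP[]] := supE.1; exact: lt_le_trans.
have ct : sup E <= t by apply: (ge_sup supE.1) => x [].
have [r' r'0 [rl rr]] := loc (sup E) (lt_trans as_ sc) (le_lt_trans ct tb).
have below y : s < y -> y < sup E -> Rel s y.
  by move=> sy /(sup_gt supE.1)[x [_ _ Hx] yx]; apply: Hx => //; exact: ltW.
have Rc : Rel s (sup E).
  pose y := Num.max ((s + sup E) / 2) (sup E - r' / 2).
  have yc : y < sup E by rewrite gt_max; apply/andP; split; lra.
  have sy : s < y by rewrite lt_max; apply/orP; left; lra.
  have ry : sup E - r' < y by rewrite lt_max; apply/orP; right; lra.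
  by apply: (tr _ y); [exact: below|apply: rl => //; lra].
have [ct'|tc] := ltP (sup E) t; last by rewrite (_ : t = sup E)//; apply/eqP; rewrite eq_le tc.
pose x := Num.min t (sup E + r' / 2).
have cx : sup E < x by rewrite lt_min ct' /=; lra.
have Ex : E x.
  split; [lra|by rewrite ge_min lexx|] => y sy yx.
  have [yc|yc|->//] := ltgtP y (sup E); first exact: below.
  move: yx; rewrite le_min => /andP[yt yr].
  by apply: (tr _ (sup E)) => //; apply: rr => //; lra.
by have /andP[_] := sE _ Ex; lra.
Qed.

Lemma interval_uncountable (a b : R) (A : set R) : a < b ->
  (forall t, a < t -> t < b -> A t) -> countable A -> False.
Proof.
move=> ab aA cA; have cI : countable `]a, b[%classic.
  by apply: sub_countable cA; apply: subset_card_le => t /=; rewrite in_itv => /andP[/aA]; exact.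
have := countable_lebesgue_measure0 cI.
rewrite lebesgue_measure_itv /= lte_fin ab => /eqP.
by rewrite -EFinB eqe subr_eq0 => /eqP; lra.
Qed.

(** Two strict maxima, each valid within the same distance and closer to one another than that,
    would each have the larger value. The maxima valid within a given distance are therefore
    isolated, hence countable, and countably many distances suffice. *)
Lemma no_interval_of_strict_local_max u a b : a < b ->
  (forall t, a < t -> t < b -> exists2 r, 0 < r &
    forall s, t - r < s -> s < t + r -> s != t -> u s < u t) -> False.
Proof.
move=> ab loc.
pose A (N : nat) := [set t | forall s, `|s - t| < N.+1%:R^-1 -> s != t -> u s < u t].
have isoA N : isolated (A N) = A N.
  apply/seteqP; split=> [|t At]; first exact: isolatedS.
  split; first exact/mem_set.
  exists (ball t N.+1%:R^-1); first exact: nbhsx_ballx.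
  apply/seteqP; split=> [s [/= ts As]|_ ->]; last by split=> //; exact: ballxx.
  apply/eqP/negPn/negP => st.
  rewrite /ball /= in ts; have := At s; rewrite distrC => /(_ ts st).
  by have := As t ts; rewrite eq_sym => /(_ st); lra.
apply: (interval_uncountable (A := \bigcup_N A N) ab).
  move=> t /loc /[apply] -[r r0 ur].
  exists (Num.truncn r^-1) => // s st.
  suff : `|s - t| < r by rewrite ltr_distl => /andP[]; exact: ur.
  by rewrite (lt_trans st)// invf_plt ?posrE// truncnS_gt.
by apply: bigcup_countable => // N _; rewrite -isoA; exact: countable_isolated.
Qed.

End OneVariable.



(** * Monotonicity and discontinuities of functions of one variable *)

Section Monotonicity.
Context {R : realType}.
Implicit Types (u v : R -> R).

Definition order_type (rel : R -> R -> Prop) :=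
  [\/ rel = (fun a b => a < b), rel = (fun a b => a = b) | rel = (fun a b => b < a)].

(* [sg = 1] or [-1] selects the right or the left side of [t]. *)
Lemma eventual_order_type (sg : R) u : definable_fun (fun e : seq R => u e`_0) ->
  exists rel, order_type rel /\ exists2 d, 0 < d & forall t, 0 < t -> t < d ->
    exists2 r, 0 < r & forall k, 0 < k -> k < r -> rel (u t) (u (t + sg * k)).
Proof.
move=> du.
pose T (rel : R -> R -> Prop) (t : R) :=
  exists r : R, 0 < r /\ forall k, 0 < k -> k < r -> rel (u t) (u (t + sg * k)).
have duk t : definable_fun (fun e : seq R => u (t + sg * e`_0)).
  by apply: (dfun_comp1 du); solve_def.
have dlt : definable (fun e => T (fun a b => a < b) e`_0).
  by rewrite /T; solve_def; apply: (dfun_comp1 du); solve_def.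
have deq : definable (fun e => T (fun a b => a = b) e`_0).
  by rewrite /T; solve_def; apply: (dfun_comp1 du); solve_def.
have type t : [\/ T (fun a b => a < b) t, T (fun a b => a = b) t | T (fun a b => b < a) t].
  have [r r0 [ur|ur]] := right_germ0 (S := fun k => u t < u (t + sg * k))
    (def_lt (dfun_const _) (duk t)).
    by constructor 1; exists r; split=> // k k0 kr; exact: ur.
  have [s s0 [us|us]] := right_germ0 (S := fun k => u t = u (t + sg * k))
    (def_eq (dfun_const _) (duk t)).
    by constructor 2; exists s; split=> // k k0 kr; exact: us.
  constructor 3; exists (Num.min r s); split; first by rewrite lt_min r0.
  move=> k k0; rewrite lt_min => /andP[kr ks].
  move: (ur k k0 kr) (us k k0 ks).
  by case: (ltgtP (u t) (u (t + sg * k))) => // _ => [/(_ isT)|_ /(_ erefl)].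
have [d d0 [Td|Td]] := right_germ0 dlt.
  exists (fun a b => a < b); split; first by constructor 1.
  by exists d => // t t0 td; have [r []] := Td t t0 td; exists r.
have [d' d'0 [Td'|Td']] := right_germ0 deq.
  exists (fun a b => a = b); split; first by constructor 2.
  by exists d' => // t t0 td; have [r []] := Td' t t0 td; exists r.
exists (fun a b => b < a); split; first by constructor 3.
exists (Num.min d d'); first by rewrite lt_min d0.
move=> t t0; rewrite lt_min => /andP[td td'].
case: (type t) => [Tt|Tt|[r []]]; last by exists r.
  by case: (Td t t0 td).
by case: (Td' t t0 td').
Qed.

Lemma order_type_refl rel a : order_type rel -> rel a a -> rel = (fun a b => a = b).
Proof. by case=> -> //; rewrite ltxx. Qed.

(* A point close to [t], on the side where [u] is constant, sees [t] on its other side. *)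
Lemma order_type_eq_sides (sg d : R) u rel rel' : sg ^+ 2 = 1 -> 0 < d ->
  order_type rel' ->
  (forall t, 0 < t -> t < d ->
    exists2 r, 0 < r & forall k, 0 < k -> k < r -> rel (u t) (u (t + sg * k))) ->
  (forall t, 0 < t -> t < d ->
    exists2 r, 0 < r & forall k, 0 < k -> k < r -> rel' (u t) (u (t - sg * k))) ->
  rel = (fun a b => a = b) -> rel' = (fun a b => a = b).
Proof.
move=> sg2 d0 ot' ur ul relE; rewrite {rel}relE in ur.
have [||r r0 Hr] := ur (d / 2); [lra|lra|].
pose k := Num.min (r / 2) (d / 4).
have k0 : 0 < k by rewrite lt_min; apply/andP; split; lra.
have kr : k <= r / 2 by rewrite ge_min lexx.
have kd : k <= d / 4 by rewrite ge_min lexx orbT.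
have sgE : sg = 1 \/ sg = -1.
  by have /eqP := sg2; rewrite sqrf_eq1 => /orP[/eqP|/eqP]; [left|right].
have [||l l0 Hl] := ul (d / 2 + sg * k); [by case: sgE => ->; lra|by case: sgE => ->; lra|].
pose k' := Num.min (l / 2) (k / 2).
have k'0 : 0 < k' by rewrite lt_min; apply/andP; split; lra.
have k'l : k' <= l / 2 by rewrite ge_min lexx.
have k'k : k' <= k / 2 by rewrite ge_min lexx orbT.
have := Hl k' k'0; rewrite -addrA -mulrBr -!Hr; [|lra..].
by move=> H; apply: (order_type_refl ot' (H _)); lra.
Qed.

Definition nondecreasing_near0 u := exists2 d, 0 < d &
  forall s t, 0 < s -> s < t -> t < d -> u s <= u t.

(** Near 0 every point has the same order type on its right and the same one on its left, which
    leaves nine combinations. Equality on one side forces equality on the other; opposite strict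
    types make [u] locally, hence globally, monotone; the two remaining ones make every point a
    strict local maximum or minimum, which is impossible on an interval. *)
Lemma definable_monotone u : definable_fun (fun e : seq R => u e`_0) ->
  nondecreasing_near0 u \/ nondecreasing_near0 (fun t => - u t).
Proof.
move=> du.
have [rr [otr [dr dr0 ur]]] := eventual_order_type 1 du.
have [rl [otl [dl dl0 ul]]] := eventual_order_type (-1) du.
pose d := Num.min dr dl; have d0 : 0 < d by rewrite lt_min dr0.
have {}ur t : 0 < t -> t < d ->
    exists2 r, 0 < r & forall k, 0 < k -> k < r -> rr (u t) (u (t + 1 * k)).
  by move=> t0; rewrite lt_min => /andP[td _]; exact: ur.
have {}ul t : 0 < t -> t < d ->
    exists2 r, 0 < r & forall k, 0 < k -> k < r -> rl (u t) (u (t + (-1) * k)).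
  by move=> t0; rewrite lt_min => /andP[_ td]; exact: ul.
have glob (rel : R -> R -> Prop) : (forall x y z, rel x y -> rel y z -> rel x z) ->
    rr = rel -> rl = (fun a b => rel b a) ->
    forall s t, 0 < s -> s < t -> t < d -> rel (u s) (u t).
  move=> tr rrE rlE.
  apply: (transitive_local_global (Rel := fun s t => rel (u s) (u t))).
    by move=> x y z; exact: tr.
  move=> t t0 td; have [r r0 Hr] := ur _ t0 td; have [l l0 Hl] := ul _ t0 td.
  exists (Num.min r l); first by rewrite lt_min r0.
  split=> s.
    move=> _; rewrite ltrBlDr -ltrBlDl lt_min => /andP[sr sl] st.
    have := Hl (t - s); rewrite rlE (_ : t + -1 * (t - s) = s); [apply; lra|ring].
  move=> _ ts; rewrite -ltrBlDl lt_min => /andP[sr sl].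
  have := Hr (s - t); rewrite rrE (_ : t + 1 * (s - t) = s); [apply; lra|ring].
have eqr : rr = (fun a b => a = b) -> rl = (fun a b => a = b).
  apply: (order_type_eq_sides (sg := 1) (expr1n _ 2) d0 otl ur) => t t0 td.
  by have [r r0 Hr] := ul _ t0 td; exists r => // k k0 kr; rewrite -mulNr; exact: Hr.
have eql : rl = (fun a b => a = b) -> rr = (fun a b => a = b).
  apply: (order_type_eq_sides (sg := -1) _ d0 otr ul); first by rewrite sqrrN expr1n.
  move=> t t0 td.
  by have [r r0 Hr] := ur _ t0 td; exists r => // k k0 kr; rewrite -mulNr opprK; exact: Hr.
have nope (f : R -> R) : (forall t, 0 < t -> t < d ->
    (exists2 r, 0 < r & forall k, 0 < k -> k < r -> f (t + 1 * k) < f t) /\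
    (exists2 r, 0 < r & forall k, 0 < k -> k < r -> f (t + (-1) * k) < f t)) -> False.
  move=> H; apply: (no_interval_of_strict_local_max (u := f) d0) => t t0 td.
  have [[r r0 Hr] [l l0 Hl]] := H t t0 td.
  exists (Num.min r l); first by rewrite lt_min r0.
  move=> s; rewrite ltrBlDr -ltrBlDl -[s < t + _]ltrBlDl !lt_min => /andP[sr1 sl1] /andP[sr2 sl2].
  rewrite neq_lt => /orP[st|ts].
    by have := Hl (t - s); rewrite (_ : t + -1 * (t - s) = s); [apply; lra|ring].
  by have := Hr (s - t); rewrite (_ : t + 1 * (s - t) = s); [apply; lra|ring].
have cst : rr = (fun a b => a = b) -> rl = (fun a b => a = b) -> nondecreasing_near0 u.
  move=> rrE rlE; exists d => // s t s0 st td; rewrite (glob (fun a b => a = b) _ rrE _ s t)//.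
    by move=> x y z ->.
  by rewrite rlE; apply/funext => a; apply/funext => b; apply/propext; split.
case: (otr) => rrE; last 1 first.
- case: (otl) => rlE; last 1 first.
  + exfalso; apply: (nope u) => t t0 td; rewrite rrE in ur; rewrite rlE in ul.
    by have [r r0 Hr] := ur _ t0 td; have [l l0 Hl] := ul _ t0 td; split; [exists r|exists l].
  + right; exists d => // s t s0 st td; rewrite lerN2.
    by apply/ltW/(glob (fun a b => b < a)) => // x y z xy yz; exact: lt_trans yz xy.
  + by left; apply: cst => //; exact: eql.
- case: (otl) => rlE.
  + exfalso; apply: (nope (fun t => - u t)) => t t0 td; rewrite rrE in ur; rewrite rlE in ul.
    have [r r0 Hr] := ur _ t0 td; have [l l0 Hl] := ul _ t0 td.
    by split; [exists r|exists l] => // k k0 kr; rewrite ltrN2; [exact: Hr|exact: Hl].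
  + by left; apply: cst => //; exact: eql.
  + left; exists d => // s t s0 st td.
    by apply/ltW/(glob (fun a b => a < b)) => // x y z; exact: lt_trans.
- by left; apply: cst => //; exact: eqr.
Qed.

(** Continuity is spelled out with quantifiers over numbers only, so that the set of continuity
    points of a definable function is definable. *)
Definition eps_continuous u (t : R) : Prop := forall eps : R, 0 < eps ->
  exists2 r : R, 0 < r & forall s, `|s - t| < r -> `|u s - u t| < eps.

(** At a discontinuity the values on the left and on the right are separated by an open gap
    [jump t]. Monotonicity makes the gaps of distinct points disjoint, and the line admits only
    countably many disjoint nonempty open sets. *)
Lemma nondecreasing_discontinuity_countable u (d : R) :
  (forall s t, 0 < s -> s < t -> t < d -> u s <= u t) ->
  countable [set t | (0 < t < d)%R /\ ~ eps_continuous u t].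
Proof.
move=> ndu; set D := [set t | _].
pose jump t := [set y | exists2 eps, 0 < eps & forall s, 0 < s -> s < d ->
  (s < t -> u s <= y - eps) /\ (t < s -> y + eps <= u s)].
(* [setT] is a filler outside [D]: openness and nonemptiness are required at every index,
   disjointness only on [D]. *)
pose B t := if pselect (D t) then jump t else setT.
have BE t : D t -> B t = jump t by move=> Dt; rewrite /B; case: pselect.
have BT t : ~ D t -> B t = setT by move=> Dt; rewrite /B; case: pselect.
apply: (@separated_open_countable _ _ B) => [t|t|].
- have [/BE ->|/BT ->] := pselect (D t); last exact: openT.
  rewrite openE => y [eps eps0 yeps]; apply/nbhs_ballP; exists (eps / 2) => /=; first lra.
  move=> z; rewrite /ball /= ltr_distl => /andP[zy yz].
  exists (eps / 2) => [|s s0 sd]; first lra.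
  by have [H1 H2] := yeps s s0 sd; split=> [/H1|/H2]; lra.
- have [Dt|/BT ->] := pselect (D t); last by exists 0.
  rewrite BE//; move: Dt => [/andP[t0 td] nc].
  have [eps eps0 neps] : exists2 eps, 0 < eps &
      ~ exists2 r, 0 < r & forall s, `|s - t| < r -> `|u s - u t| < eps.
    apply: contrapT => H; apply: nc => eps eps0; apply: contrapT => H'.
    by apply: H; exists eps.
  (* Either all later values lie [eps] above [u t], or all earlier ones lie [eps] below it, and the
     gap is on that side. Otherwise points [l < t < r] have values within [eps] of [u t], and by
     monotonicity so does everything between them. *)
  have [right_jump|] := pselect (forall s, t < s -> s < d -> u t + eps <= u s).
    exists (u t + eps / 2), (eps / 2); first lra.
    move=> s s0 sd; split=> [st|/right_jump/(_ sd)]; last lra.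
    by have := ndu _ _ s0 st td; lra.
  have [left_jump _|] := pselect (forall s, 0 < s -> s < t -> u s <= u t - eps).
    exists (u t - eps / 2), (eps / 2); first lra.
    move=> s s0 sd; split=> [/(left_jump _ s0)|ts]; first lra.
    by have := ndu _ _ t0 ts sd; lra.
  move=> /existsNP[l /not_implyP[l0 /not_implyP[lt /negP]]]; rewrite -ltNge => ul.
  move=> /existsNP[r /not_implyP[tr /not_implyP[rd /negP]]]; rewrite -ltNge => ur.
  exfalso; apply: neps; exists (Num.min (t - l) (r - t)).
    by rewrite lt_min !subr_gt0 lt.
  move=> s; rewrite ltr_distl ltrBlDr -ltrBlDl -[s < _]ltrBlDl !lt_min.
  move=> /andP[/andP[s1 s2] /andP[s3 s4]].
  have ls : l < s by lra.
  have sr : s < r by lra.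
  have := ndu _ _ l0 ls (lt_trans sr rd); have := ndu _ _ (lt_trans l0 ls) sr rd.
  by move=> H1 H2; rewrite ltr_distl; apply/andP; split; lra.
- move=> t t' Dt Dt'; rewrite !BE// => -[y [[eps eps0 yt] [eps' eps'0 yt']]].
  move: Dt Dt' => [/andP[t0 td] _] [/andP[t'0 t'd] _].
  have m0 : 0 < (t + t') / 2 by lra.
  have md : (t + t') / 2 < d by lra.
  have [H1 H2] := yt _ m0 md; have [H1' H2'] := yt' _ m0 md.
  have [tt'|tt'|//] := ltgtP t t'; exfalso.
    by have : u ((t + t') / 2) <= y - eps'; [apply: H1'; lra|have := H2 ltac:(lra); lra].
  by have : u ((t + t') / 2) <= y - eps; [apply: H1; lra|have := H2' ltac:(lra); lra].
Qed.

End Monotonicity.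



(** * Definable choice and curve selection *)

Section DefinableChoice.
Context {R : realType}.
Implicit Types (u v : R -> R).

(** By the germ property [u] is either continuous at all small positive points or discontinuous at
    all of them, and the latter contradicts the countability of the discontinuities. *)
Lemma definable_regular u : definable_fun (fun e : seq R => u e`_0) ->
  exists2 sg : R, `|sg| = 1 & exists2 d, 0 < d &
    (forall s t, 0 < s -> s < t -> t < d -> sg * u s <= sg * u t) /\
    (forall t, 0 < t -> t < d -> eps_continuous u t).
Proof.
move=> du.
have dcont (w : R -> R) : definable_fun (fun e : seq R => w e`_0) ->
    definable (fun e => eps_continuous w e`_0).
  move=> dw; apply: (@def_ext _ (fun e => forall eps : R, 0 < eps ->
      exists r : R, 0 < r /\ forall s, `|s - e`_0| < r -> `|w s - w e`_0| < eps)).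
    by solve_def; apply: (dfun_comp1 dw); solve_def.
  move=> e; split=> wc eps eps0; have := wc eps eps0.
    by move=> [r [r0 rw]]; exists r.
  by move=> [r r0 rw]; exists r.
have cont (w : R -> R) : definable_fun (fun e : seq R => w e`_0) ->
    nondecreasing_near0 w -> exists2 d, 0 < d &
    (forall s t, 0 < s -> s < t -> t < d -> w s <= w t) /\
    (forall t, 0 < t -> t < d -> eps_continuous w t).
  move=> dw [d d0 ndw].
  have [r r0 [wc|wnc]] := right_germ0 (dcont w dw).
    exists (Num.min d r); first by rewrite lt_min d0.
    split=> [s t s0 st|t t0]; rewrite lt_min => /andP[td tr]; last exact: wc.
    exact: ndw.
  exfalso; have dr0 : 0 < Num.min d r by rewrite lt_min d0.
  apply: (interval_uncountable dr0 _ (nondecreasing_discontinuity_countable ndw)) => t t0.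
  by rewrite lt_min => /andP[td tr] /=; rewrite t0 td; split=> //; exact: wnc.
have [/(cont _ du)[d d0 [ndu cu]]|] := definable_monotone du.
  exists 1; first by rewrite normr1.
  by exists d => //; split=> // s t s0 st td; rewrite !mul1r; exact: ndu.
move=> /(cont _ (dfun_opp du))[d d0 [ndu cu]].
exists (-1); first by rewrite normrN1.
exists d => //; split=> [s t s0 st td|t t0 td eps eps0].
  by rewrite !mulN1r; exact: ndu.
have [r r0 ru] := cu t t0 td eps eps0.
by exists r => // s /ru; rewrite -opprD normrN.
Qed.

Lemma def_rel2 (Q : R -> R -> Prop) (w1 w2 : seq R -> R) :
  definable (fun e : seq R => Q e`_0 e`_1) -> definable_fun w1 -> definable_fun w2 ->
  definable (fun e => Q (w1 e) (w2 e)).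
Proof.
move=> dQ d1 d2; apply: (@def_let2 _ w1 w2 (fun a b e => Q a b)) => //.
apply: (def_comp (s := fun e => [:: e`_1; e`_0]) dQ) => -[|[|i]] /=.
- exact: poly_var.
- exact: poly_var.
- by rewrite nth_nil; exact: poly_const.
Qed.

(** The value 0 over empty fibres makes the function total while keeping its graph definable. *)
Lemma definable_choice_unique (G : R -> R -> Prop) :
  definable (fun e : seq R => G e`_0 e`_1) ->
  (forall t a b, G t a -> G t b -> a = b) ->
  exists2 u, definable_fun (fun e : seq R => u e`_0) &
    forall t, (exists a, G t a) -> G t (u t).
Proof.
move=> dG Guniq; exists (fun t => xget 0 [set a | G t a]); last first.
  by move=> t [a Ga]; case: xgetP => [x _ //|/(_ a)].
apply: (@def_ext _ (fun e => G e`_1 e`_0 \/ (~ (exists a, G e`_1 a) /\ e`_0 = 0))).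
  by solve_def; apply: (def_rel2 dG); solve_def.
move=> e; rewrite nth_behead; case: xgetP => [x -> Gx|nG].
  split=> [[Ga|[nex _]]|->]; [exact: Guniq Gx| |by left].
  by exfalso; apply: nex; eexists; exact: Gx.
by split=> [[/nG []|[_ ->]]|->]//; right; split=> // -[a /nG].
Qed.

(* The infimum of the fibre if it is attained, and otherwise the midpoint of
   the maximal interval of length at most 1 of the fibre that starts there. *)
Lemma definable_choice1 (Q : R -> R -> Prop) b :
  definable (fun e : seq R => Q e`_0 e`_1) -> (forall t x, Q t x -> b <= x) ->
  exists2 u, definable_fun (fun e : seq R => u e`_0) &
    forall t, (exists x, Q t x) -> Q t (u t).
Proof.
move=> dQ Qb.
pose isinf t i := (forall x, Q t x -> i <= x) /\
  (forall j, (forall x, Q t x -> j <= x) -> j <= i).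
(* The bound [i + 1] keeps the supremum finite when the fibre contains a half-line. *)
pose T t i c := i < c /\ (c <= i + 1 /\ forall x, i < x -> x < c -> Q t x).
pose issup t i c := (forall x, T t i x -> x <= c) /\
  (forall d, (forall x, T t i x -> x <= d) -> c <= d).
pose G t a := exists i, isinf t i /\
  ((Q t i /\ a = i) \/ (~ Q t i /\ exists c, issup t i c /\ a = (i + c) / 2)).
have inf_uniq t i j : isinf t i -> isinf t j -> i = j.
  by move=> [li gi] [lj gj]; apply/le_anti/andP; split; [exact: gj|exact: gi].
have sup_uniq t i c d : issup t i c -> issup t i d -> c = d.
  by move=> [li gi] [lj gj]; apply/le_anti/andP; split; [exact: gi|exact: gj].
have [u du Gu] : exists2 u, definable_fun (fun e : seq R => u e`_0) &
    forall t, (exists a, G t a) -> G t (u t).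
  apply: definable_choice_unique.
    rewrite /G /isinf /issup /T.
    by solve_def; apply: (def_rel2 dQ); solve_def.
  move=> t a a' [i [infi Hi]] [i' [infi' Hi']].
  rewrite -(inf_uniq _ _ _ infi infi') in Hi'.
  case: Hi => [[Qi ->]|[nQi [c [supc ->]]]]; case: Hi' => [[Qi' ->]|[nQi' [c' [supc' ->]]]] //.
  by rewrite (sup_uniq _ _ _ _ supc supc').
exists u => // t [x0 Qx0].
have has_infQ : has_inf [set x | Q t x].
  by split; [exists x0|exists b => x /Qb].
pose i := inf [set x | Q t x].
have infi : isinf t i.
  split=> [x Qx|j jQ]; first exact: (ge_inf has_infQ.2).
  by apply: (lb_le_inf has_infQ.1) => x; exact: jQ.
have [Qi|nQi] := pselect (Q t i).
  have [|j [infj [[Qj ->//]|[nQj _]]]] := Gu t; first by exists i, i; split=> //; left.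
  by rewrite -(inf_uniq _ _ _ infi infj) in nQj.
have dQt : definable (fun e : seq R => (fun x => Q t x) e`_0).
  by apply: (def_rel2 dQ); solve_def.
(* If the fibre had no points just to the right of [i], the infimum would have to be attained. *)
have [r r0 [rQ|rnQ]] := right_germ i dQt; last first.
  exfalso; have [x Qx xr] : exists2 x, Q t x & x < i + r by apply: (inf_lt has_infQ.1); rewrite ltrDl.
  have := infi.1 x Qx; rewrite le_eqVlt => /predU1P[ix|ix]; first by rewrite ix in nQi.
  exact: rnQ xr Qx.
pose c0 := i + Num.min r 1.
have Tc0 : T t i c0.
  split; first by rewrite ltrDl lt_min r0 /=.
  split; first by rewrite lerD2l ge_min lexx orbT.
  by move=> x ix; rewrite /c0 -ltrBlDl lt_min ltrBlDl => /andP[xr _]; exact: rQ.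
have has_supT : has_sup [set c | T t i c].
  by split; [exists c0|exists (i + 1) => x [_ []]].
pose c := sup [set c | T t i c].
have supc : issup t i c.
  split=> [x Tx|d dT]; first exact: (ub_le_sup has_supT.2).
  by apply: (ge_sup has_supT.1) => x; exact: dT.
have [|j [infj H]] := Gu t.
  by exists ((i + c) / 2), i; split=> //; right; split=> //; exists c.
rewrite -(inf_uniq _ _ _ infi infj) in H.
case: H => [[//]|[_ [c' [supc' ->]]]]; rewrite -(sup_uniq _ _ _ _ supc supc').
have ic : i < c by apply: (lt_le_trans _ (supc.1 _ Tc0)); case: Tc0.
have /(sup_gt has_supT.1)[y [iy [_ Ty]] ycl] : (i + c) / 2 < c by lra.
by apply: Ty => //; lra.
Qed.

(** Coordinates are chosen one at a time: the first from the projection of the fibre, the others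
    after substituting that choice for the first. The lower bound provides the infimum used for one
    coordinate. *)
Lemma definable_choice N (P : seq R -> Prop) b : definable P ->
  (forall e i, P e -> (i < N)%N -> b <= e`_i.+1) ->
  exists2 u : nat -> R -> R, (forall i, definable_fun (fun e : seq R => u i e`_0)) &
    forall t, (exists w, size w = N /\ P (t :: w)) -> P (t :: mkseq (u^~ t) N).
Proof.
elim: N P => [|N IH] P dP Pb.
  exists (fun _ _ => 0) => [i|t [w [/size0nil ->]]//].
  exact: dfun_const.
pose Q t x := exists w, size w = N /\ P [:: t, x & w].
have dQ : definable (fun e => Q e`_0 e`_1).
  (* [def_exseq] puts the [N] witnesses in front of the environment, which moves [t] and [x] to the
     indices [N] and [N + 1]. *)
  have dP' : definable (fun e => P [:: e`_N, e`_N.+1 & take N e]).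
    apply: (def_comp dP) => -[|[|i]] /=; [exact: poly_var|exact: poly_var|].
    have [iN|Ni] := ltnP i N; first by under eq_fun do rewrite nth_take//; exact: poly_var.
    under eq_fun => e do rewrite nth_default ?(leq_trans _ Ni) ?size_take_min ?geq_minl//.
    exact: poly_const.
  apply: (def_ext (def_exseq N dP')) => e.
  split=> -[w [wN Pw]]; exists w; split=> //; move: Pw;
    by rewrite take_size_cat// !nth_cat wN ltnn ltnNge leqnSn /= subnn subSnn.
have [v dv Qv] : exists2 v, definable_fun (fun e : seq R => v e`_0) &
    forall t, (exists x, Q t x) -> Q t (v t).
  by apply: (definable_choice1 (b := b) dQ) => t x [w [_ /Pb]] => /(_ 0%N isT).
have [||u du uP] := IH (fun e => P (e`_0 :: v e`_0 :: behead e)).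
- apply: (@def_let _ (fun e => v e`_0) (fun a e => P (e`_0 :: a :: behead e))) => //.
  apply: (def_comp dP) => -[|[|i]] /=.
  + exact: poly_nth_behead.
  + exact: poly_var.
  + by under eq_fun do rewrite !nth_behead; exact: poly_var.
- by move=> e i /Pb H iN; have := H i.+1 iN; rewrite /= nth_behead.
exists (fun i => if i is i'.+1 then u i' else v) => [[|i]|t [w [wN Pw]]] //.
have [w' [w'N Pw']] : Q t (v t).
  apply: Qv; case: w wN Pw => [//|x w] [wN] Pw.
  by exists x, w.
have /= := uP t (ex_intro _ w' (conj w'N Pw')).
by rewrite /mkseq /= (iotaDl 1 0) -map_comp.
Qed.

End DefinableChoice.



(** * Curve selection and the decay of a function along curves *)

Section CurveSelection.
Context {R : realType}.

Lemma finite_common_bound (I : finType) (D : I -> R) : (forall i, 0 < D i) ->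
  exists2 d, 0 < d & forall i, d <= D i.
Proof.
move=> D0; exists (\big[Num.min/1]_i D i).
  by elim/big_ind : _ => // x y x0 y0; rewrite lt_min x0.
by move=> i; rewrite (bigD1 i)//= ge_min lexx.
Qed.

(** The parameter is an upper bound for the distance to [zs]: choosing for each [t] a point of [A]
    with coordinates within [t] of those of [zs] forces the curve to [zs]. [definable_regular] then
    applies to each coordinate. *)
Lemma curve_selection N (A : 'cV[R]_N -> Prop) (zs : 'cV[R]_N) :
  definable (fun e => A (colseq N e)) ->
  (forall d, 0 < d -> exists2 z, A z & forall i, `|z i 0 - zs i 0| <= d) ->
  exists (z : R -> 'cV[R]_N) (sg : 'I_N -> R) (d : R), [/\ 0 < d,
    forall i, `|sg i| = 1,
    forall t, 0 < t -> t < d -> A (z t) /\ forall i, `|z t i 0 - zs i 0| <= t,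
    forall i s t, 0 < s -> s < t -> t < d -> sg i * z s i 0 <= sg i * z t i 0 &
    forall i t, 0 < t -> t < d -> eps_continuous (fun t => z t i 0) t].
Proof.
move=> dA Azs.
pose P (e : seq R) := A (colseq N (behead e)) /\ (e`_0 <= 1 /\
  forall i : 'I_N, `|e`_i.+1 - zs i 0| <= e`_0).
have dP : definable P.
  apply: def_and; first exact: (def_behead dA).
  apply: def_and; first by solve_def.
  by apply: def_all => i; solve_def.
(* A lower bound common to all coordinates, valid because [P] restricts the parameter to at most
   1. *)
pose b : R := - (\sum_i `|zs i 0|) - 1.
have Pb e i : P e -> (i < N)%N -> b <= e`_i.+1.
  move=> [_ [e1 Pe]] iN; have := Pe (Ordinal iN); rewrite ler_distl /= => /andP[H _].
  apply: le_trans H; rewrite /b lerB// lerNl.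
  apply: (@le_trans _ _ `|zs (Ordinal iN) 0|); first by rewrite -normrN ler_norm.
  by rewrite (bigD1 (Ordinal iN))//= lerDl sumr_ge0.
have [u du uP] := definable_choice dP Pb.
pose z t : 'cV[R]_N := \col_i u i t.
have {}uP t : 0 < t -> t <= 1 -> A (z t) /\ forall i, `|z t i 0 - zs i 0| <= t.
  move=> t0 t1; have [|H1 [_ H2]] := uP t.
    have [w Aw wt] := Azs t t0; exists [seq w i 0 | i <- enum 'I_N].
    have sw : size [seq w i 0 | i <- enum 'I_N] = N by rewrite size_map size_enum_ord.
    have nw (i : 'I_N) : [seq w i 0 | i <- enum 'I_N]`_i = w i 0.
      by rewrite (nth_map i) ?size_enum_ord// nth_ord_enum.
    split=> //; split=> /=.
      by congr A: Aw; apply/matrixP => i j; rewrite mxE nw ord1.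
    by split=> // i; rewrite nw.
  split=> [|i]; last by have := H2 i; rewrite /= nth_mkseq// mxE.
  by congr A: H1; apply/matrixP => i j; rewrite !mxE /= nth_mkseq.
have /choice[sg sgP] : forall i : 'I_N, exists sg : R, `|sg| = 1 /\ exists2 d, 0 < d &
    (forall s t, 0 < s -> s < t -> t < d -> sg * u i s <= sg * u i t) /\
    (forall t, 0 < t -> t < d -> eps_continuous (u i) t).
  by move=> i; have [sg sg1 H] := definable_regular (du i); exists sg.
have /choice[D DP] : forall i : 'I_N, exists d, 0 < d /\
    (forall s t, 0 < s -> s < t -> t < d -> sg i * u i s <= sg i * u i t) /\
    (forall t, 0 < t -> t < d -> eps_continuous (u i) t).
  by move=> i; have [_ [d d0 H]] := sgP i; exists d.
have [d d0 dD] := finite_common_bound (fun i => (DP i).1).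
have lt1 t : t < Num.min d 1 -> t < d /\ t < 1 by rewrite lt_min => /andP[].
exists z, sg, (Num.min d 1); split=> //.
- by rewrite lt_min d0 /=.
- by move=> i; have [] := sgP i.
- by move=> t t0 /lt1[_ /ltW]; exact: uP.
- move=> i s t s0 st /lt1[td _]; rewrite !mxE; have [_ [H _]] := DP i.
  by apply: H => //; exact: lt_le_trans td (dD i).
- move=> i t t0 /lt1[td _]; have [_ [_ H]] := DP i.
  have := H t t0 (lt_le_trans td (dD i)).
  by congr eps_continuous; apply/funext => x; rewrite mxE.
Qed.

(** It follows from [1 + 2x <= expR (2x)] and from [(1 + 2x)(1 - x) >= 1] on this range. This
    estimate is why the weight in [no_slow_approach] has the rate [2 * K]: the slope is bounded only
    relative to the value at the centre, so to its left the loss is [1 - K D]. *)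
Lemma expR_N2x_le (x : R) : 0 <= x -> x <= 2^-1 -> expR (- (2 * x)) <= 1 - x.
Proof.
move=> x0 x1; rewrite expRN.
apply: (@le_trans _ _ (1 + 2 * x)^-1).
  by rewrite lef_pV2 ?posrE ?expR_gt0 ?expR_ge1Dx//; lra.
by rewrite -div1r ler_pdivrMr; [nra|lra].
Qed.

(* The slope of [log psi] at [z] is at most [K]. *)
Definition slow_point N (psi : 'cV[R]_N -> R) (K : R) (z : 'cV[R]_N) : Prop :=
  0 < psi z /\ exists r, 0 < r /\ forall w : 'cV[R]_N,
    (forall i, `|w i 0 - z i 0| < r) ->
    `|psi w - psi z| <= K * psi z * \sum_i `|w i 0 - z i 0|.

Lemma slow_point_definable N (psi : 'cV[R]_N -> R) K :
  definable_fun (fun e => psi (colseq N e)) ->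
  definable (fun e => slow_point psi K (colseq N e)).
Proof.
move=> dpsi; rewrite /slow_point; apply: def_and; first by solve_def.
apply: def_ex; cbn beta; apply: def_and; first by solve_def.
have dpsi1 : definable_fun (fun e => psi (colseq N (behead e))) by exact: (dfun_behead dpsi).
have dpsi2 : definable_fun (fun e => psi (colseq N (behead (drop N e)))).
  exact: (dfun_drop N dpsi1).
have dcol i : definable_fun (fun e => colseq N e i 0).
  by under eq_fun do rewrite mxE; exact: dfun_var.
have dcold i : definable_fun (fun e => colseq N (behead (drop N e)) i 0).
  by under eq_fun do rewrite mxE nth_behead nth_drop; exact: dfun_var.
apply: (@def_fav _ N (fun w e =>
  (forall i, `|w i 0 - colseq N (behead e) i 0| < e`_0) ->
  `|psi w - psi (colseq N (behead e))| <=
    K * psi (colseq N (behead e)) * \sum_i `|w i 0 - colseq N (behead e) i 0|)).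
apply: def_imp.
  apply: def_all => i; apply: def_lt; last by under eq_fun do rewrite nth_drop; exact: dfun_var.
  exact/dfun_abs/dfun_sub.
apply: def_le; first exact/dfun_abs/dfun_sub.
apply: dfun_mul; first by apply: dfun_mul => //; exact: dfun_const.
by apply: dfun_sum => i; exact/dfun_abs/dfun_sub.
Qed.

(* A weak form of the Lojasiewicz inequality: along a curve of slow points of
   finite length [log psi] would have finite variation. *)
Lemma no_slow_approach N (psi : 'cV[R]_N -> R) (zs : 'cV[R]_N) (K : R) : 0 < K ->
  definable_fun (fun e => psi (colseq N e)) ->
  (forall eps, 0 < eps -> exists2 r, 0 < r & forall z : 'cV[R]_N,
     (forall i, `|z i 0 - zs i 0| < r) -> psi z < eps) ->
  (forall d, 0 < d -> exists2 z, slow_point psi K z & forall i, `|z i 0 - zs i 0| <= d) ->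
  False.
Proof.
move=> K0 dpsi psi_cvg /(curve_selection (slow_point_definable K dpsi)).
move=> [z [sg [d [d0 sg1 slow mono cont]]]].
(* Increments of [ell] are lengths of the curve in the sum norm, because every [sg i * z t i 0] is
   nondecreasing. Weighting by the exponential turns the bound on the slope of [log psi] into
   monotonicity of [G]. *)
pose H t := psi (z t); pose ell t := \sum_i sg i * z t i 0.
pose G t := H t * expR (- (2 * K * ell t)).
have sgn i (x : R) : 0 <= sg i * x -> `|x| = sg i * x.
  by move=> /ger0_norm; rewrite normrM sg1 mul1r.
have dist s t : 0 < s -> s < t -> t < d ->
    \sum_i `|z t i 0 - z s i 0| = ell t - ell s.
  move=> s0 st td; rewrite /ell -sumrB; apply: eq_bigr => i _.
  by rewrite (sgn i) mulrBr// subr_ge0; exact: mono.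
have Kpos (x : R) : 0 <= x -> 0 <= K * x by move=> x0; rewrite mulr_ge0// ltW.
have Gdecr : forall s t, 0 < s -> s < t -> t < d -> G t <= G s.
  apply: (transitive_local_global (Rel := fun s t => G t <= G s)).
    by move=> x y w xy yw; exact: le_trans yw xy.
  move=> t t0 td; have [[Ht [r [r0 Lip]]] _] := slow t t0 td.
  (* The second term keeps [K] times the length at most one half, as [expR_N2x_le] requires; [N.+1]
     avoids a division by 0 when [N = 0]. *)
  pose r' := Num.min r ((2 * K)^-1 / N.+1%:R).
  have r'0 : 0 < r' by rewrite lt_min r0 divr_gt0// invr_gt0 mulr_gt0.
  have /choice[D DP] : forall i, exists l, 0 < l /\
      forall s, `|s - t| < l -> `|z s i 0 - z t i 0| < r'.
    by move=> i; have [l l0 Hl] := cont i t t0 td r' r'0; exists l.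
  have [l l0 lD] := finite_common_bound (fun i => (DP i).1).
  have near s : `|s - t| < l -> `|H s - H t| <= K * H t * (\sum_i `|z s i 0 - z t i 0|) /\
      K * (\sum_i `|z s i 0 - z t i 0|) <= 2^-1.
    move=> st; have zst i : `|z s i 0 - z t i 0| < r'.
      by apply: (DP i).2; exact: lt_le_trans st (lD i).
    split; first by apply: Lip => i; apply: lt_le_trans (zst i) _; rewrite ge_min lexx.
    rewrite -ler_pdivlMl//; apply: (@le_trans _ _ (\sum_(i < N) (2 * K)^-1 / N.+1%:R)).
      by apply: ler_sum => i _; apply/ltW/(lt_le_trans (zst i)); rewrite ge_min lexx orbT.
    have nN : N.+1%:R^-1 * N%:R <= 1 :> R.
      by rewrite mulrC ler_pdivrMr// mul1r ler_nat.
    rewrite sumr_const card_ord -[_ *+ N]mulr_natr -mulrA.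
    rewrite (_ : (2 * K)^-1 = K^-1 * 2^-1); last by rewrite invfM mulrC.
    by rewrite ler_piMr// mulr_ge0 ?invr_ge0 ?ltW.
  exists l => //; split=> s.
    move=> s0 ls st; have [|] := near s.
      by rewrite ltr_distl; apply/andP; split; lra.
    have -> : \sum_i `|z s i 0 - z t i 0| = ell t - ell s.
      by rewrite -(dist s t)//; apply: eq_bigr => i _; rewrite distrC.
    set D' := ell t - ell s => Hst KD.
    have D'0 : 0 <= D' by rewrite /D' -(dist s t)// sumr_ge0.
    have He := expR_N2x_le (Kpos _ D'0) KD.
    rewrite /G (_ : - (2 * K * ell t) = - (2 * (K * D')) + - (2 * K * ell s)); last first.
      by rewrite /D'; ring.
    rewrite expRD mulrA ler_pM2r ?expR_gt0//.
    apply: (@le_trans _ _ (H t * (1 - K * D'))); first by rewrite ler_pM2l.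
    by move: Hst; rewrite ler_distl => /andP[+ _]; lra.
  move=> sd ts sl; have [|] := near s.
    by rewrite ltr_distl; apply/andP; split; lra.
  rewrite dist//; set D' := ell s - ell t => Hst _.
  have D'0 : 0 <= D' by rewrite /D' -(dist t s)// sumr_ge0.
  rewrite /G (_ : - (2 * K * ell t) = 2 * (K * D') + - (2 * K * ell s)); last by rewrite /D'; ring.
  rewrite expRD mulrA ler_pM2r ?expR_gt0//.
  apply: (@le_trans _ _ (H t * (1 + 2 * (K * D')))); last by rewrite ler_pM2l// expR_ge1Dx.
  move: Hst; rewrite ler_distl => /andP[_]; have := Kpos _ D'0.
  move=> KD H1; apply: (le_trans H1); rewrite /H in Ht *.
  by have := mulr_ge0 (ltW Ht) KD; lra.
(* Finite length: coordinates stay within [d] of those of [zs], so [ell] is bounded below. As [G]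
   does not decrease towards 0, [psi] stays above a positive constant along the curve. *)
pose M := \sum_i (`|zs i 0| + d).
have ellM t : 0 < t -> t < d -> - M <= ell t.
  move=> t0 td; rewrite lerNl /M /ell -sumrN; apply: ler_sum => i _.
  apply: (@le_trans _ _ `|z t i 0|).
    by rewrite -[leRHS]mul1r -(sg1 i) -normrM -normrN ler_norm.
  have [_ /(_ i) H1] := slow t t0 td.
  by have := ler_normD (z t i 0 - zs i 0) (zs i 0); rewrite subrK; lra.
have h0 : 0 < d / 2 by lra.
have hd : d / 2 < d by lra.
have G0 : 0 < G (d / 2).
  by rewrite mulr_gt0 ?expR_gt0//; have [[]] := slow _ h0 hd.
have [|r r0 small] := psi_cvg (G (d / 2) * expR (- (2 * K * M))).
  by rewrite mulr_gt0 ?expR_gt0.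
pose t := Num.min (r / 2) (d / 4).
have t0 : 0 < t by rewrite lt_min; apply/andP; split; lra.
have tr : t <= r / 2 by rewrite ge_min lexx.
have tq : t <= d / 4 by rewrite ge_min lexx orbT.
have td : t < d by lra.
have [_ zt] := slow t t0 td.
have : psi (z t) < G (d / 2) * expR (- (2 * K * M)).
  by apply: small => i; apply: (le_lt_trans (zt i)); lra.
apply/negP; rewrite -leNgt.
have Gt : G (d / 2) <= G t by apply: Gdecr => //; lra.
apply: (@le_trans _ _ (G t * expR (- (2 * K * M)))); first by rewrite ler_pM2r ?expR_gt0.
rewrite /G -mulrA -expRD ler_piMr//; first by have [[/ltW]] := slow _ t0 td.
rewrite -[leRHS]expR0 ler_expR; have ellMt := ellM t t0 td.
have KM : 0 <= K * (M + ell t) by apply: Kpos; lra.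
by lra.
Qed.

End CurveSelection.


(** * Gradients *)

Section Gradient.
Context {R : realType}.

Lemma lt_minl (x r s : R) : x < Num.min r s -> x < r.
Proof. by rewrite lt_min => /andP[]. Qed.

Lemma lt_minr (x r s : R) : x < Num.min r s -> x < s.
Proof. by rewrite lt_min => /andP[]. Qed.

Lemma mx_norm_lt N (v : 'cV[R]_N) r : 0 < r -> (forall i, `|v i 0| < r) -> `|v| < r.
Proof.
move=> r0 vr; rewrite [ltLHS]/Num.Def.normr/= mx_normrE.
by apply: bigmax_lt => // -[i j] _; rewrite ord1.
Qed.

Lemma le_mx_norm N (v : 'cV[R]_N) i : `|v i 0| <= `|v|.
Proof.
rewrite [leRHS]/Num.Def.normr/= mx_normrE.
exact: (le_bigmax _ (fun ij : 'I_N * 'I_1 => `|v ij.1 ij.2|) (i, 0)).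
Qed.

Lemma mx_norm_le_sum N (v : 'cV[R]_N) : `|v| <= \sum_i `|v i 0|.
Proof.
rewrite [leLHS]/Num.Def.normr/= mx_normrE; apply: bigmax_le; first exact: sumr_ge0.
by move=> [i j] _ /=; rewrite ord1 (bigD1 i)//= lerDl sumr_ge0.
Qed.

Lemma near_col N (z : 'cV[R]_N) (P : 'cV[R]_N -> Prop) :
  (\forall w \near z, P w) <->
  exists2 r, 0 < r & forall w : 'cV[R]_N, (forall i, `|w i 0 - z i 0| < r) -> P w.
Proof.
split.
  move=> /nbhs_ballP[r /= r0 rP]; exists r => // w wz; apply: rP.
  rewrite -ball_normE /=; apply: mx_norm_lt => // i.
  by rewrite !mxE distrC.
move=> [r r0 rP]; apply/nbhs_ballP; exists r => //= w.
rewrite -ball_normE /= => wz; apply: rP => i; apply: le_lt_trans wz.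
by have := le_mx_norm (z - w) i; rewrite !mxE distrC.
Qed.

Lemma cvg_colP N (x : nat -> 'cV[R]_N) (l : 'cV[R]_N) :
  x @ \oo --> l <-> forall i, (fun k => x k i 0) @ \oo --> l i 0.
Proof.
split=> [xl i|xl].
  apply/cvgrPdist_lt => eps eps0; move/cvgrPdist_lt : xl => /(_ _ eps0).
  apply: filterS => k; apply: le_lt_trans.
  by have := le_mx_norm (l - x k) i; rewrite !mxE.
apply/cvgrPdist_lt => eps eps0.
have : \forall k \near \oo, forall i, `|l i 0 - x k i 0| < eps.
  by apply: filter_forall => i; exact: (cvgrPdist_lt _ _).1 (xl i) _ eps0.
by apply: filterS => k H; apply: mx_norm_lt => // i; rewrite !mxE.
Qed.

(** Frechet differentiability with the remainder measured in the sum norm, the form in which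
    [slow_point] bounds increments. *)
Definition is_grad N (F : 'cV[R]_N -> R) (z a : 'cV[R]_N) : Prop :=
  forall eps, 0 < eps -> exists2 r, 0 < r & forall w : 'cV[R]_N,
    (forall i, `|w i 0 - z i 0| < r) ->
    `|F w - F z - \sum_i a i 0 * (w i 0 - z i 0)| <= eps * \sum_i `|w i 0 - z i 0|.

Lemma is_grad_differentiable N (F : 'cV[R]_N -> R) z :
  differentiable F z -> is_grad F z (grad F z).
Proof.
move=> dF eps eps0.
have [_ /eqaddoP/(_ eps eps0)] := (diff_locallyP _ _).1 dF.
move=> /near_col[r r0 Hr]; exists r => // w wz.
have wz0 i : `|(w - z) i 0 - (0 : 'cV[R]_N) i 0| < r by rewrite !mxE subr0; exact: wz.
have H : `|F w - F z - 'd F z (w - z)| <= eps * `|w - z|.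
  by have := Hr (w - z) wz0; rewrite !fctE /= subrK opprD addrA.
have {}H : `|F w - F z - 'd F z (w - z)| <= eps * \sum_i `|w i 0 - z i 0|.
  apply: le_trans H _; rewrite ler_pM2l//; apply: le_trans (mx_norm_le_sum _) _.
  by apply: ler_sum => i _; rewrite !mxE.
have dE : 'd F z (w - z) = \sum_i grad F z i 0 * (w i 0 - z i 0).
  rewrite {1}(matrix_sum_delta (w - z)) linear_sum; apply: eq_bigr => i _.
  by rewrite big_ord1 linearZ /= /grad !mxE deriveE// mulrC.
by rewrite -dE.
Qed.

Lemma grad_is_grad N (F : 'cV[R]_N -> R) z a : is_grad F z a -> grad F z = a.
Proof.
move=> Fa; apply/matrixP => i j; rewrite mxE ord1.
apply/cvg_lim => //; apply/cvgrPdist_le => eps eps0.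
have [r r0 Hr] := Fa eps eps0.
near=> k.
have k0 : k != 0 by near: k; exact: nbhs_dnbhs_neq.
have kr : `|k| < r by near: k; exact: dnbhs0_lt.
pose w := k *: delta_mx i 0 + z : 'cV[R]_N.
have wz l : w l 0 - z l 0 = if l == i then k else 0.
  by rewrite !mxE eqxx andbT addrK; case: eqP; rewrite ?mulr1 ?mulr0.
have := Hr w; rewrite (bigD1 i)//= big1 ?addr0 => [|l /negPf li]; last by rewrite wz li mulr0.
rewrite (bigD1 i)//= big1 ?addr0 => [|l /negPf li]; last by rewrite wz li normr0.
rewrite !wz eqxx => H.
rewrite -/w distrC -(ler_pM2r (x := `|k|)) ?normr_gt0// -normrM.
have -> : (k^-1 *: (F w - F z) - a i 0) * k = F w - F z - a i 0 * k.
  by rewrite mulrBl -[_ *: _]/(_ * _) mulrAC mulVf// mul1r.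
by apply: H => l; rewrite wz; case: ifP => // _; rewrite normr0.
Unshelve. all: by end_near. Qed.

Lemma is_grad_const N (c : R) (z : 'cV[R]_N) : is_grad (fun=> c) z 0.
Proof.
move=> eps eps0; exists 1 => // w _; rewrite subrr sub0r normrN big1 ?normr0.
  by apply: mulr_ge0; [exact: ltW|exact: sumr_ge0].
by move=> i _; rewrite mxE mul0r.
Qed.

Lemma is_grad_coord N (z : 'cV[R]_N) i : is_grad (fun w => w i 0) z (delta_mx i 0).
Proof.
move=> eps eps0; exists 1 => // w _.
rewrite (bigD1 i)//= big1 => [|l /negPf li]; last by rewrite mxE li mul0r.
by rewrite mxE !eqxx mul1r addr0 subrr normr0; apply: mulr_ge0; [exact: ltW|exact: sumr_ge0].
Qed.

Lemma is_grad_add N (F G : 'cV[R]_N -> R) z a b :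
  is_grad F z a -> is_grad G z b -> is_grad (fun w => F w + G w) z (a + b).
Proof.
move=> Fa Gb eps eps0; have e2 : 0 < eps / 2 by lra.
have [r r0 Hr] := Fa _ e2; have [s s0 Hs] := Gb _ e2.
exists (Num.min r s); first by rewrite lt_min r0.
move=> w wz.
have {}Hr := Hr w (fun i => lt_minl (wz i)).
have {}Hs := Hs w (fun i => lt_minr (wz i)).
have -> : \sum_i (a + b) i 0 * (w i 0 - z i 0) =
    \sum_i a i 0 * (w i 0 - z i 0) + \sum_i b i 0 * (w i 0 - z i 0).
  by rewrite -big_split /=; apply: eq_bigr => i _; rewrite mxE mulrDl.
move: Hr Hs; set A := \sum_i a i 0 * _; set B := \sum_i b i 0 * _ => Hr Hs.
have -> : F w + G w - (F z + G z) - (A + B) = (F w - F z - A) + (G w - G z - B) by ring.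
by apply: le_trans (ler_normD _ _) _; lra.
Qed.

Lemma is_grad_sum N I (r : seq I) (F : I -> 'cV[R]_N -> R) z (a : I -> 'cV[R]_N) :
  (forall i, is_grad (F i) z (a i)) ->
  is_grad (fun w => \sum_(i <- r) F i w) z (\sum_(i <- r) a i).
Proof.
move=> Fa; elim: r => [|i r IH].
  by rewrite big_nil; under eq_fun do rewrite big_nil; exact: is_grad_const.
by rewrite big_cons; under eq_fun do rewrite big_cons; exact: is_grad_add.
Qed.

(** A quadratic bound on the remainder of [phi] is assumed instead of a second derivative, so that
    the squared positive part, which has a kink in its derivative, is covered along with squares and
    scalings. *)
Lemma is_grad_chain N (F : 'cV[R]_N -> R) z a (phi : R -> R) (c M : R) :
  (forall b, `|phi b - phi (F z) - c * (b - F z)| <= M * (b - F z) ^+ 2) ->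
  is_grad F z a -> is_grad (fun w => phi (F w)) z (c *: a).
Proof.
move=> phic Fa eps eps0.
have M0 : 0 <= M.
  have := phic (F z + 1); rewrite [F z + 1]addrC addrK expr1n !mulr1.
  by move=> H; exact: le_trans (normr_ge0 _) H.
pose L := \sum_i `|a i 0| + 1.
have L1 : 1 <= L by rewrite lerDr sumr_ge0.
(* The tolerance 1 gives the Lipschitz bound [L] on the increment of [F]; the other one makes the
   linear part of the error at most [eps / 2 * D]. *)
have e1 : 0 < Num.min 1 (eps / 2 / (`|c| + 1)).
  by rewrite lt_min ltr01 /= !divr_gt0//; have := normr_ge0 c; lra.
have [r r0 Hr] := Fa _ e1.
(* Within this radius the quadratic error [M * (L * D) ^+ 2] is at most [eps / 2 * D]. *)
pose s := eps / 2 / (M * L ^+ 2 + 1) / N.+1%:R.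
have ML : 0 <= M * L ^+ 2 by rewrite mulr_ge0 ?sqr_ge0.
have s0 : 0 < s by rewrite /s !divr_gt0//; lra.
exists (Num.min r s); first by rewrite lt_min r0.
move=> w wz.
have {}Hr := Hr w (fun i => lt_minl (wz i)).
set A := \sum_i a i 0 * (w i 0 - z i 0) in Hr.
set D := \sum_i `|w i 0 - z i 0| in Hr *.
have D0 : 0 <= D by exact: sumr_ge0.
have -> : \sum_i (c *: a) i 0 * (w i 0 - z i 0) = c * A.
  by rewrite mulr_sumr; apply: eq_bigr => i _; rewrite mxE mulrA.
have AL : `|A| <= (L - 1) * D.
  rewrite /L addrK mulr_suml; apply: le_trans (ler_norm_sum _ _ _) _.
  apply: ler_sum => i _; rewrite normrM ler_wpM2l//.
  by rewrite /D (bigD1 i)//= lerDl sumr_ge0.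
have FL : `|F w - F z| <= L * D.
  have H1 : `|F w - F z - A| <= 1 * D.
    by apply: le_trans Hr _; rewrite ler_wpM2r// ge_min lexx.
  have := ler_normD (F w - F z - A) A; rewrite subrK; lra.
have DMs : (M * L ^+ 2 + 1) * D <= eps / 2.
  apply: (@le_trans _ _ ((M * L ^+ 2 + 1) * (s * N.+1%:R))).
    rewrite ler_pM2l; last lra.
    apply: (@le_trans _ _ (\sum_(i < N) s)).
      by apply: ler_sum => i _; apply/ltW/(lt_le_trans (wz i)); rewrite ge_min lexx orbT.
    rewrite sumr_const card_ord -[_ *+ _]mulr_natr ler_pM2l// ler_nat; exact: leqnSn.
  rewrite /s divfK// mulrC divfK//; lra.
have -> : phi (F w) - phi (F z) - c * A =
  (phi (F w) - phi (F z) - c * (F w - F z)) + c * (F w - F z - A) by ring.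
apply: le_trans (ler_normD _ _) _.
have H1 : `|c * (F w - F z - A)| <= eps / 2 * D.
  rewrite normrM; apply: (@le_trans _ _ (`|c| * (eps / 2 / (`|c| + 1) * D))).
    rewrite ler_wpM2l//; apply: le_trans Hr _; rewrite ler_wpM2r//.
    by rewrite ge_min lexx orbT.
  rewrite mulrA ler_wpM2r// mulrCA ler_piMr//; first lra.
  rewrite ler_pdivrMr; have := normr_ge0 c; lra.
have H2 : M * (F w - F z) ^+ 2 <= eps / 2 * D.
  apply: (@le_trans _ _ (M * (L * D) ^+ 2)).
    by rewrite ler_wpM2l// -[leLHS]real_normK ?num_real// ler_sqr ?nnegrE//; apply: mulr_ge0 => //; lra.
  rewrite exprMn mulrA [D ^+ 2]expr2 mulrA ler_wpM2r//.
  by apply: le_trans DMs; rewrite mulrDl lerDl; lra.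
have := phic (F w); lra.
Qed.

Lemma is_grad_scale N (F : 'cV[R]_N -> R) z a c :
  is_grad F z a -> is_grad (fun w => c * F w) z (c *: a).
Proof.
by apply: (is_grad_chain (phi := fun b => c * b) (M := 0)) => b; rewrite -mulrBr subrr normr0 mul0r.
Qed.

Lemma is_grad_sqr N (F : 'cV[R]_N -> R) z a :
  is_grad F z a -> is_grad (fun w => F w ^+ 2) z ((2 * F z) *: a).
Proof.
apply: (is_grad_chain (phi := fun b => b ^+ 2) (M := 1)) => b.
by rewrite (_ : _ - _ = (b - F z) ^+ 2); [rewrite ger0_norm ?sqr_ge0// mul1r|ring].
Qed.

Lemma is_grad_pos_sqr N (F : 'cV[R]_N -> R) z a :
  is_grad F z a -> is_grad (fun w => pos_part (F w) ^+ 2) z ((2 * pos_part (F z)) *: a).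
Proof.
apply: (is_grad_chain (phi := fun b => pos_part b ^+ 2) (M := 1)) => b.
rewrite /pos_part mul1r ler_norml.
have := sqr_ge0 (b - F z); have := sqr_ge0 b; have := sqr_ge0 (F z).
case: (lerP b 0) => b0; case: (lerP (F z) 0) => z0 ? ? ?; apply/andP.
- by split; lra.
- by have := mulr_le0_ge0 b0 (ltW z0); split; lra.
- by have := mulr_ge0_le0 (ltW b0) z0; split; lra.
- by split; lra.
Qed.

Lemma is_grad_mul N (F G : 'cV[R]_N -> R) z a b :
  is_grad F z a -> is_grad G z b -> is_grad (fun w => F w * G w) z (G z *: a + F z *: b).
Proof.
move=> Fa Gb.
(* Polarization reduces the product to squares. *)
have H := is_grad_add (is_grad_scale 2^-1 (is_grad_sqr (is_grad_add Fa Gb)))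
  (is_grad_scale (- 2^-1) (is_grad_add (is_grad_sqr Fa) (is_grad_sqr Gb))).
rewrite (_ : (fun w => F w * G w) =
    (fun w => 2^-1 * (F w + G w) ^+ 2 + - 2^-1 * (F w ^+ 2 + G w ^+ 2))).
  congr is_grad: H; apply/matrixP => i j; by rewrite !mxE; field.
by apply/funext => w; field.
Qed.

Lemma is_grad_usubmx n1 n2 (F : 'cV[R]_n1 -> R) (z : 'cV[R]_(n1 + n2)) a :
  is_grad F (usubmx z) a -> is_grad (fun w => F (usubmx w)) z (col_mx a 0).
Proof.
move=> Fa eps eps0; have [r r0 Hr] := Fa _ eps0; exists r => // w wz.
have := Hr (usubmx w) (fun i => _); rewrite !big_split_ord /=.
under eq_bigr do rewrite !mxE.
move=> /(_ _)/wrap[]; first by move=> i; rewrite !mxE; exact: wz.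
rewrite [\sum_(i < n2) _ * _]big1 ?addr0; last by move=> i _; rewrite col_mxEd mxE mul0r.
under [in X in _ -> X]eq_bigr do rewrite col_mxEu.
move=> H; apply: le_trans H _; rewrite ler_pM2l//.
under eq_bigr do rewrite !mxE.
by rewrite lerDl sumr_ge0.
Qed.

Lemma is_grad_continuous N (F : 'cV[R]_N -> R) z a eps : is_grad F z a -> 0 < eps ->
  exists2 r, 0 < r & forall w : 'cV[R]_N, (forall i, `|w i 0 - z i 0| < r) -> `|F w - F z| < eps.
Proof.
move=> /(_ 1 ltr01)[r r0 Hr] eps0.
pose L := \sum_i `|a i 0| + 1.
have L1 : 1 <= L by rewrite lerDr sumr_ge0.
pose s := eps / L / N.+1%:R.
have s0 : 0 < s by rewrite /s !divr_gt0//; lra.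
exists (Num.min r s); first by rewrite lt_min r0.
move=> w wz.
have {}Hr := Hr w (fun i => lt_minl (wz i)).
set A := \sum_i a i 0 * (w i 0 - z i 0) in Hr.
set D := \sum_i `|w i 0 - z i 0| in Hr *.
have AL : `|A| <= (L - 1) * D.
  rewrite /L addrK mulr_suml; apply: le_trans (ler_norm_sum _ _ _) _.
  apply: ler_sum => i _; rewrite normrM ler_wpM2l//.
  by rewrite /D (bigD1 i)//= lerDl sumr_ge0.
have FL : `|F w - F z| <= L * D.
  by have := ler_normD (F w - F z - A) A; rewrite subrK; lra.
apply: (le_lt_trans FL); rewrite mulrC -ltr_pdivlMr; last lra.
apply: (@le_lt_trans _ _ (\sum_(i < N) s)).
  by apply: ler_sum => i _; apply/ltW/(lt_le_trans (wz i)); rewrite ge_min lexx orbT.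
rewrite sumr_const card_ord -[_ *+ _]mulr_natr /s mulrAC ltr_pdivrMr//.
by rewrite ltr_pM2l ?ltr_nat// divr_gt0//; lra.
Qed.

End Gradient.



(** * Gradient of the augmented Lagrangian *)

Section AugmentedLagrangian.
Context {R : realType}.

Lemma is_grad_eq N (F : 'cV[R]_N -> R) z a b : is_grad F z a -> a = b -> is_grad F z b.
Proof. by move=> ? <-. Qed.

Lemma pos_part_scale (rho t l : R) : 0 < rho ->
  rho * pos_part (t + rho^-1 * l) = pos_part (rho * t + l).
Proof.
move=> rho0; rewrite /pos_part maxr_pMr ?ltW// mulr0 mulrDr mulrA divff ?mul1r//.
exact: lt0r_neq0.
Qed.

Lemma differentiable_row n m (G : 'cV[R]_n -> 'cV[R]_m) x j :
  differentiable G x -> differentiable (fun z => G z j 0) x.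
Proof.
move=> dG; apply: (@differentiable_comp _ _ _ _ G (fun M : 'cV[R]_m => M j 0)) => //.
exact: differentiable_coord.
Qed.

Lemma is_grad_row n1 n2 m (G : 'cV[R]_n1 -> 'cV[R]_m) (z : 'cV[R]_(n1 + n2)) j :
  differentiable G (usubmx z) ->
  is_grad (fun w => G (usubmx w) j 0) z (col_mx (grad (fun x => G x j 0) (usubmx z)) 0).
Proof.
move=> /(differentiable_row j) dG.
exact: (is_grad_usubmx (is_grad_differentiable dG)).
Qed.

Lemma is_grad_add_const N (F : 'cV[R]_N -> R) z a c :
  is_grad F z a -> is_grad (fun w => F w + c) z a.
Proof. by move=> Fa; rewrite -[a]addr0; apply: is_grad_add => //; exact: is_grad_const. Qed.

Lemma is_grad_pos_penalty n1 n2 m (G : 'cV[R]_n1 -> 'cV[R]_m) (z : 'cV[R]_(n1 + n2))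
    (l : 'cV[R]_m) rho : 0 < rho -> differentiable G (usubmx z) ->
  is_grad (fun w => rho / 2 * sqnorm (vpos (G (usubmx w) + rho^-1 *: l))) z
    (col_mx (grads G (usubmx z) *m vpos (rho *: G (usubmx z) + l)) 0).
Proof.
move=> rho0 dG; rewrite /sqnorm.
under eq_fun => w do under eq_bigr => j _ do rewrite !mxE.
have H j := is_grad_pos_sqr (is_grad_add_const (rho^-1 * l j 0) (is_grad_row j dG)).
apply: is_grad_eq (is_grad_scale (rho / 2) (is_grad_sum (index_enum _) H)) _.
apply/matrixP => i k; rewrite ord1 mxE summxE.
case: (split_ordP i) => i' ->.
  rewrite [RHS]col_mxEu mxE mulr_sumr; apply: eq_bigr => j _.
  by rewrite mxE col_mxEu !mxE -(pos_part_scale _ _ rho0); field.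
rewrite [RHS]col_mxEd mxE big1 ?mulr0// => j _.
by rewrite mxE col_mxEd mxE mulr0.
Qed.

Lemma is_grad_penalty n1 n2 m (G : 'cV[R]_n1 -> 'cV[R]_m) (z : 'cV[R]_(n1 + n2))
    (l : 'cV[R]_m) rho : 0 < rho -> differentiable G (usubmx z) ->
  is_grad (fun w => rho / 2 * sqnorm (G (usubmx w) + rho^-1 *: l)) z
    (col_mx (grads G (usubmx z) *m (rho *: G (usubmx z) + l)) 0).
Proof.
move=> rho0 dG; rewrite /sqnorm.
under eq_fun => w do under eq_bigr => j _ do rewrite !mxE.
have H j := is_grad_sqr (is_grad_add_const (rho^-1 * l j 0) (is_grad_row j dG)).
apply: is_grad_eq (is_grad_scale (rho / 2) (is_grad_sum (index_enum _) H)) _.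
apply/matrixP => i k; rewrite ord1 mxE summxE.
case: (split_ordP i) => i' ->.
  rewrite [RHS]col_mxEu mxE mulr_sumr; apply: eq_bigr => j _.
  by rewrite mxE col_mxEu !mxE; field; exact: lt0r_neq0.
rewrite [RHS]col_mxEd mxE big1 ?mulr0// => j _.
by rewrite mxE col_mxEd mxE mulr0.
Qed.

Lemma is_grad_hadamard_penalty n (z : 'cV[R]_(n + n)) (l : 'cV[R]_n) rho : 0 < rho ->
  let gam := rho *: hadamard (usubmx z) (dsubmx z) + l in
  is_grad (fun w => rho / 2 * sqnorm (hadamard (usubmx w) (dsubmx w) + rho^-1 *: l)) z
    (col_mx (hadamard gam (dsubmx z)) (hadamard gam (usubmx z))).
Proof.
move=> rho0 gam; rewrite /sqnorm.
under eq_fun => w do under eq_bigr => j _ do rewrite !mxE.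
have H j := is_grad_sqr (is_grad_add_const (rho^-1 * l j 0)
  (is_grad_mul (is_grad_coord z (lshift n j)) (is_grad_coord z (rshift n j)))).
apply: is_grad_eq (is_grad_scale (rho / 2) (is_grad_sum (index_enum _) H)) _.
apply/matrixP => i k; rewrite ord1 mxE summxE.
case: (split_ordP i) => i' ->.
  rewrite [RHS]col_mxEu (bigD1 i')//= big1 ?addr0 => [|j /negPf ji].
    by rewrite !mxE !eqxx eq_lrshift /=; field; exact: lt0r_neq0.
  rewrite !mxE (inj_eq (@lshift_inj _ _)) (eq_sym i' j) ji eq_lrshift /=.
  by rewrite !mulr0 addr0 mulr0.
rewrite [RHS]col_mxEd (bigD1 i')//= big1 ?addr0 => [|j /negPf ji].
  by rewrite !mxE !eqxx eq_rlshift /=; field; exact: lt0r_neq0.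
rewrite !mxE (inj_eq (@rshift_inj _ _)) (eq_sym i' j) ji eq_rlshift /=.
by rewrite !mulr0 addr0 mulr0.
Qed.

Lemma is_grad_gap_penalty n (kappa : int) (z : 'cV[R]_(n + n)) (l : R) rho : 0 < rho ->
  is_grad (fun w => rho / 2 * pos_part (card_gap kappa (dsubmx w) + l / rho) ^+ 2) z
    (col_mx 0 (- const_mx (pos_part (rho * card_gap kappa (dsubmx z) + l)))).
Proof.
move=> rho0; rewrite /card_gap.
have -> : (fun w : 'cV[R]_(n + n) => rho / 2 *
    pos_part (n%:R - kappa%:~R - \sum_i dsubmx w i 0 + l / rho) ^+ 2) =
    (fun w => rho / 2 *
    pos_part ((- 1) * (\sum_i w (rshift n i) 0) + (n%:R - kappa%:~R + l / rho)) ^+ 2).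
  apply/funext => w; congr (_ * pos_part _ ^+ 2).
  by under eq_bigr do rewrite mxE; ring.
apply: is_grad_eq (is_grad_scale (rho / 2) (is_grad_pos_sqr (is_grad_add_const _
  (is_grad_scale (-1) (is_grad_sum (index_enum _) (fun i => is_grad_coord z (rshift n i))))))) _.
apply/matrixP => i k; rewrite ord1 3!mxE summxE.
case: (split_ordP i) => i' ->.
  rewrite [RHS]col_mxEu mxE [X in _ * (_ * (_ * X))]big1 ?mulr0// => j _.
  by rewrite mxE eq_lrshift.
have -> : \sum_k (delta_mx (rshift n k) 0 : 'cV[R]_(n + n)) (rshift n i') 0 = 1.
  rewrite (bigD1 i')//= big1 ?addr0 => [|j /negPf ji]; first by rewrite mxE !eqxx.
  by rewrite mxE (inj_eq (@rshift_inj _ _)) (eq_sym i' j) ji.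
rewrite [RHS]col_mxEd !mxE.
have -> : pos_part (rho * (n%:R - kappa%:~R - \sum_i0 dsubmx z i0 0) + l) =
   rho * pos_part (- 1 * (\sum_i z (rshift n i) 0) + (n%:R - kappa%:~R + l / rho)).
  rewrite -(pos_part_scale _ _ rho0); congr (_ * pos_part _).
  by under eq_bigr do rewrite mxE; rewrite [rho^-1 * l]mulrC; ring.
by field.
Qed.

Lemma is_grad_bound_penalty n (z : 'cV[R]_(n + n)) (l : 'cV[R]_n) rho : 0 < rho ->
  is_grad (fun w => rho / 2 * sqnorm (vpos (dsubmx w - const_mx 1 + rho^-1 *: l))) z
    (col_mx 0 (vpos (rho *: (dsubmx z - const_mx 1) + l))).
Proof.
move=> rho0; rewrite /sqnorm.
under eq_fun => w do under eq_bigr => j _ do rewrite !mxE.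
have H j := is_grad_pos_sqr (is_grad_add_const (rho^-1 * l j 0)
  (is_grad_add_const (-1) (is_grad_coord z (rshift n j)))).
apply: is_grad_eq (is_grad_scale (rho / 2) (is_grad_sum (index_enum _) H)) _.
apply/matrixP => i k; rewrite ord1 mxE summxE.
case: (split_ordP i) => i' ->.
  rewrite [RHS]col_mxEu mxE big1 ?mulr0// => j _.
  by rewrite !mxE eq_lrshift mulr0.
rewrite [RHS]col_mxEd !mxE (bigD1 i')//= big1 ?addr0 => [|j /negPf ji]; last first.
  by rewrite !mxE (inj_eq (@rshift_inj _ _)) (eq_sym i' j) ji mulr0.
by rewrite !mxE !eqxx /= -(pos_part_scale _ _ rho0); field.
Qed.

Section Gradient.
Context {n m p : nat}.
Variables (f : 'cV[R]_n -> R) (g : 'cV[R]_n -> 'cV[R]_m) (h : 'cV[R]_n -> 'cV[R]_p)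
  (kappa : int).

(** The updates of the method are exactly the factors produced by differentiating the penalty terms,
    since [rho] times the positive part of [t + l / rho] is that of [rho t + l]. In the [x] block,
    [gamma] appears multiplied by [y]. *)
Lemma is_grad_aug_lagrangian (z : 'cV[R]_(n + n)) (L : multipliers) rho :
  let x := usubmx z in let y := dsubmx z in
  let U := multiplier_update g h kappa x y L rho in
  0 < rho -> differentiable f x -> differentiable g x -> differentiable h x ->
  is_grad (fun w => aug_lagrangian f g h kappa (usubmx w) (dsubmx w) L rho) z
    (col_mx (grad f x + grads g x *m mult_lam U + grads h x *m mult_mu U
             + hadamard (mult_gam U) y)
            (hadamard (mult_gam U) x - const_mx (mult_del U) + mult_eta U)).
Proof.
move=> x y U rho0 df dg dh.
under eq_fun do rewrite /aug_lagrangian !(mulrDr (rho / 2)).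
apply: is_grad_eq (is_grad_add (is_grad_usubmx (is_grad_differentiable df))
  (is_grad_add (is_grad_add (is_grad_add (is_grad_add
    (is_grad_pos_penalty (mult_lam L) rho0 dg)
    (is_grad_penalty (mult_mu L) rho0 dh))
    (is_grad_hadamard_penalty z (mult_gam L) rho0))
    (is_grad_gap_penalty kappa z (mult_del L) rho0))
    (is_grad_bound_penalty z (mult_eta L) rho0))) _.
by rewrite !add_col_mx !add0r !addr0 !addrA.
Qed.

Lemma grad_aug_lagrangianE (x y : 'cV[R]_n) (L : multipliers) rho :
  let U := multiplier_update g h kappa x y L rho in
  0 < rho -> differentiable f x -> differentiable g x -> differentiable h x ->
  grad_aug_lagrangian f g h kappa x y L rho =
    col_mx (grad f x + grads g x *m mult_lam U + grads h x *m mult_mu U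
             + hadamard (mult_gam U) y)
            (hadamard (mult_gam U) x - const_mx (mult_del U) + mult_eta U).
Proof.
move=> U rho0 df dg dh; apply: grad_is_grad.
by have := @is_grad_aug_lagrangian (col_mx x y) L rho; rewrite col_mxKu col_mxKd; exact.
Qed.

End Gradient.
End AugmentedLagrangian.



(** * Decay of the scaled infeasibility *)

Section Penalty.
Context {R : realType}.

Lemma penalty_vanishes N (psi : 'cV[R]_N -> R) (a : 'cV[R]_N -> 'cV[R]_N) (zs : 'cV[R]_N)
    (z : nat -> 'cV[R]_N) (rho : nat -> R) (C c : R) :
  definable_fun (fun e => psi (colseq N e)) ->
  (forall w, is_grad psi w (a w)) -> psi zs = 0 -> (forall w, 0 <= psi w) ->
  (forall i, (fun k => z k i 0) @ \oo --> zs i 0) ->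
  (forall k, 0 < rho k) ->
  (\forall k \near \oo, forall i, `|rho k * a (z k) i 0| <= C) ->
  0 < c -> \forall k \near \oo, rho k * psi (z k) < c.
Proof.
move=> dpsi psi_grad psi_zs psi0 zzs rho0 aC c0.
apply: contrapT => freq.
(* [|C| / c] bounds the gradient of [psi] relative to [psi] wherever [rho psi >= c]. The extra 1
   absorbs the remainder of the first-order expansion, taken at [z k] with tolerance [psi (z k)]. *)
pose K := `|C| / c + 1.
have K0 : 0 < K by rewrite ltr_wpDl// divr_ge0// ltW.
apply: (no_slow_approach (psi := psi) (zs := zs) K0) => // [eps eps0|d d0].
  have [r r0 Hr] := is_grad_continuous (psi_grad zs) eps0.
  exists r => // w /Hr; rewrite psi_zs subr0; exact: le_lt_trans (ler_norm _).
have zd : \forall k \near \oo, forall i, `|z k i 0 - zs i 0| <= d.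
  apply: filter_forall => i; have /cvgrPdist_le/(_ _ d0) := zzs i.
  by apply: filterS => k; rewrite distrC.
have [k [ak [zk ck]]] : exists k, (forall i, `|rho k * a (z k) i 0| <= C) /\
    ((forall i, `|z k i 0 - zs i 0| <= d) /\ c <= rho k * psi (z k)).
  apply: contrapT => H; apply: freq; near=> k.
  rewrite ltNge; apply/negP => ck; apply: H; exists k; split; first by near: k.
  by split=> //; near: k.
exists (z k) => //.
have psik : 0 < psi (z k) by rewrite -(pmulr_rgt0 _ (rho0 k)); exact: lt_le_trans ck.
split=> //; have [r r0 Hr] := psi_grad (z k) _ psik.
exists r; split=> // w /Hr H.
set D := \sum_i `|w i 0 - z k i 0| in H *.
have D0 : 0 <= D by exact: sumr_ge0.
have aD : `|\sum_i a (z k) i 0 * (w i 0 - z k i 0)| <= `|C| / c * psi (z k) * D.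
  rewrite mulr_sumr; apply: le_trans (ler_norm_sum _ _ _) _.
  apply: ler_sum => i _; rewrite normrM ler_wpM2r//.
  rewrite mulrAC ler_pdivlMr// -(ler_pM2l (rho0 k)).
  apply: (@le_trans _ _ (`|C| * c)).
    rewrite mulrA ler_pM2r// -[rho k]gtr0_norm// -normrM.
    by apply: le_trans (ak i) _; exact: ler_norm.
  by rewrite mulrCA ler_wpM2l.
set A := \sum_i _ * _ in aD H.
have := ler_normD (psi w - psi (z k) - A) A; rewrite subrK /K => H2.
apply: (le_trans H2); rewrite 2!mulrDl mul1r; lra.
Unshelve. all: by end_near. Qed.

Lemma C1_row_cvg n m (G : 'cV[R]_n -> 'cV[R]_m) (x : nat -> 'cV[R]_n) xs i j :
  continuously_differentiable G -> x @ \oo --> xs ->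
  (fun k => grads G (x k) i j) @ \oo --> grads G xs i j.
Proof.
move=> [dG cG] xxs.
have gradsE w : grads G w i j = 'D_(delta_mx i 0) G w j 0.
  by rewrite !mxE derive_mx ?mxE//; exact: diff_derivable.
rewrite gradsE; under eq_fun do rewrite gradsE.
have := (cvg_colP _ _).1 (continuous_cvg _ (cG (delta_mx i 0) xs) xxs) j.
exact.
Qed.

Lemma C1_grad_cvg n (F : 'cV[R]_n -> R) (x : nat -> 'cV[R]_n) xs :
  continuously_differentiable F -> x @ \oo --> xs ->
  (fun k => grad F (x k)) @ \oo --> grad F xs.
Proof.
move=> [dF cF] xxs; apply/cvg_colP => i; rewrite mxE; under eq_fun do rewrite mxE.
exact: (continuous_cvg _ (cF (delta_mx i 0) xs) xxs).
Qed.

Definition zero_multipliers n m p : @multipliers R n m p := Multipliers 0 0 0 0 0.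

Section Infeasibility.
Context {n m p : nat}.
Variables (g : 'cV[R]_n -> 'cV[R]_m) (h : 'cV[R]_n -> 'cV[R]_p) (kappa : int).

(** The function psi of the overview. As an augmented Lagrangian with zero objective, zero
    multipliers and penalty 1, it inherits its gradient from [is_grad_aug_lagrangian]. *)
Definition infeasibility (z : 'cV[R]_(n + n)) : R :=
  aug_lagrangian (fun=> 0) g h kappa (usubmx z) (dsubmx z) (zero_multipliers n m p) 1.

Lemma infeasibilityE z : infeasibility z = 2^-1 *
  (\sum_j pos_part (g (usubmx z) j 0) ^+ 2 + \sum_j (h (usubmx z) j 0) ^+ 2 +
   \sum_i (usubmx z i 0 * dsubmx z i 0) ^+ 2 +
   pos_part (card_gap kappa (dsubmx z)) ^+ 2 + \sum_i pos_part (dsubmx z i 0 - 1) ^+ 2).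
Proof.
rewrite /infeasibility /aug_lagrangian /= !scaler0 !addr0 add0r mul1r mul0r addr0.
congr (_ * (_ + _ + _ + _ + _)); by apply: eq_bigr => i _; rewrite !mxE.
Qed.

Lemma infeasibility_ge0 z : 0 <= infeasibility z.
Proof.
by rewrite infeasibilityE mulr_ge0// !addr_ge0 ?sqr_ge0//; apply: sumr_ge0 => i _; exact: sqr_ge0.
Qed.

Lemma complementarity_le_infeasibility (x y : 'cV[R]_n) i :
  (x i 0 * y i 0) ^+ 2 <= 2 * infeasibility (col_mx x y).
Proof.
rewrite infeasibilityE mulrA mulfV// mul1r col_mxKu col_mxKd.
apply: (@le_trans _ _ (\sum_i (x i 0 * y i 0) ^+ 2)).
  by rewrite (bigD1 i)//= lerDl; apply: sumr_ge0 => j _; exact: sqr_ge0.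
have := sqr_ge0 (pos_part (card_gap kappa y)).
have : 0 <= \sum_j pos_part (g x j 0) ^+ 2 by apply: sumr_ge0 => j _; exact: sqr_ge0.
have : 0 <= \sum_j h x j 0 ^+ 2 by apply: sumr_ge0 => j _; exact: sqr_ge0.
have : 0 <= \sum_j pos_part (y j 0 - 1) ^+ 2 by apply: sumr_ge0 => j _; exact: sqr_ge0.
lra.
Qed.

Lemma infeasibility_eq0 x y : relaxation_feasible g h kappa x y ->
  infeasibility (col_mx x y) = 0.
Proof.
move=> [gx hx xy gap yx]; rewrite infeasibilityE col_mxKu col_mxKd.
have pos0 t : t <= 0 -> pos_part t = 0 by move=> t0; rewrite /pos_part max_r.
rewrite !big1 ?pos0// => [|i _|i _|i _|i _]; rewrite ?expr0n/= ?addr0 ?mulr0//.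
- by rewrite pos0 ?expr0n//; have := yx i; lra.
- by have /matrixP/(_ i 0) := xy; rewrite !mxE => ->; rewrite expr0n.
- by rewrite hx mxE expr0n.
- by rewrite pos0 ?expr0n.
Qed.

Lemma infeasibility_definable : semialgebraic g -> semialgebraic h ->
  definable_fun (fun e => infeasibility (colseq (n + n) e)).
Proof.
move=> sg sh.
under eq_fun do rewrite infeasibilityE.
have xE e : usubmx (colseq (n + n) e) = colseq n e.
  by apply/matrixP => i j; rewrite !mxE.
have yE e i : dsubmx (colseq (n + n) e) i 0 = e`_(n + i) by rewrite !mxE.
have dy i : definable_fun (fun e => dsubmx (colseq (n + n) e) i 0).
  by under eq_fun do rewrite yE; exact: dfun_var.
have dx i : definable_fun (fun e => usubmx (colseq (n + n) e) i 0).
  by under eq_fun do rewrite xE mxE; exact: dfun_var.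
have dg j : definable_fun (fun e => g (usubmx (colseq (n + n) e)) j 0).
  by under eq_fun do rewrite xE; exact: semialgebraic_definable.
have dh j : definable_fun (fun e => h (usubmx (colseq (n + n) e)) j 0).
  by under eq_fun do rewrite xE; exact: semialgebraic_definable.
have dsq (u : seq R -> R) : definable_fun u -> definable_fun (fun e => u e ^+ 2).
  by move=> du; under eq_fun do rewrite expr2; exact: dfun_mul.
have dpos (u : seq R -> R) : definable_fun u -> definable_fun (fun e => pos_part (u e)).
  by move=> du; apply: dfun_max => //; exact: dfun_const.
apply: dfun_mul; first exact: dfun_const.
apply: dfun_add; last first.
  by apply: dfun_sum => i; apply/dsq/dpos/dfun_sub => //; exact: dfun_const.
apply: dfun_add; last first.
  by apply/dsq/dpos/dfun_sub; [exact: dfun_const|exact: dfun_sum].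
apply: dfun_add; last by apply: dfun_sum => i; apply/dsq/dfun_mul.
apply: dfun_add; last by apply: dfun_sum => i; apply/dsq.
by apply: dfun_sum => i; apply/dsq/dpos.
Qed.

Definition infeasibility_grad (z : 'cV[R]_(n + n)) : 'cV[R]_(n + n) :=
  let x := usubmx z in let y := dsubmx z in
  col_mx (grads g x *m vpos (g x) + grads h x *m h x + hadamard (hadamard x y) y)
         (hadamard (hadamard x y) x - const_mx (pos_part (card_gap kappa y))
          + vpos (y - const_mx 1)).

Lemma infeasibility_is_grad z : (forall x, differentiable g x) ->
  (forall x, differentiable h x) -> is_grad infeasibility z (infeasibility_grad z).
Proof.
move=> dg dh.
have d0 : differentiable (fun=> 0 : R) (usubmx z) by exact: differentiable_cst.
apply: is_grad_eq (is_grad_aug_lagrangian kappa (zero_multipliers n m p) ltr01 d0 (dg _) (dh _)) _.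
rewrite (grad_is_grad (is_grad_const 0 (usubmx z))) /infeasibility_grad /=.
by rewrite !scale1r !addr0 mul1r add0r.
Qed.

Lemma pos_part_lipschitz (a b : R) : `|pos_part a - pos_part b| <= `|a - b|.
Proof.
rewrite /pos_part; case: (lerP a 0) => a0; case: (lerP b 0) => b0; rewrite ?subrr ?normr0//.
- by rewrite sub0r normrN (gtr0_norm b0) distrC; apply: le_trans (ler_norm _); lra.
- by rewrite subr0 (gtr0_norm a0); apply: le_trans (ler_norm _); lra.
Qed.

(* The gradients of the augmented Lagrangian and of [rho] times the
   infeasibility differ by terms that only involve the bounded safeguarded
   multipliers. *)
Lemma infeasibility_grad_bound f (x y : 'cV[R]_n) (L : multipliers) rho B (k : 'I_(n + n)) :
  0 < rho -> differentiable f x -> differentiable g x -> differentiable h x ->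
  (forall j, `|mult_lam L j 0| <= B) -> (forall j, `|mult_mu L j 0| <= B) ->
  (forall j, `|mult_gam L j 0| <= B) -> `|mult_del L| <= B ->
  (forall j, `|mult_eta L j 0| <= B) ->
  `|rho * infeasibility_grad (col_mx x y) k 0| <=
  `|grad_aug_lagrangian f g h kappa x y L rho k 0| +
  \sum_i (`|grad f x i 0| + B * (\sum_j `|grads g x i j| + \sum_j `|grads h x i j|
   + `|x i 0| + `|y i 0| + 2)).
Proof.
move=> rho0 df dg dh BL BM BG BD BE.
have B0 : 0 <= B by exact: le_trans BD.
(* One bound serves both blocks: the sums and [y] are for the [x] block, while in the [y] block [x]
   comes from [gamma] and 2 counts [delta] and [eta]. *)
pose S i := `|grad f x i 0| + B * (\sum_j `|grads g x i j| + \sum_j `|grads h x i j|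
   + `|x i 0| + `|y i 0| + 2).
have S0 i : 0 <= S i.
  by rewrite addr_ge0// mulr_ge0// !addr_ge0//; apply: sumr_ge0.
suff H : exists i, `|rho * infeasibility_grad (col_mx x y) k 0 -
    grad_aug_lagrangian f g h kappa x y L rho k 0| <= S i.
  have [i Hi] := H; rewrite -[X in `|X| <= _](subrK (grad_aug_lagrangian f g h kappa x y L rho k 0)).
  rewrite addrC; apply: le_trans (ler_normD _ _) _; rewrite lerD2l.
  by apply: (le_trans Hi); rewrite (bigD1 i)//= lerDl; apply: sumr_ge0 => l _; exact: S0.
rewrite grad_aug_lagrangianE// /infeasibility_grad col_mxKu col_mxKd.
have posB t l : `|l| <= B -> `|rho * pos_part t - pos_part (rho * t + l)| <= B.
  move=> lB; have -> : rho * pos_part t = pos_part (rho * t).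
    by have := pos_part_scale t 0 rho0; rewrite mulr0 !addr0.
  by apply: le_trans (pos_part_lipschitz _ _) _; rewrite opprD addNKr normrN.
have sumB q (G : 'M[R]_(n, q)) i (u v : 'I_q -> R) : (forall j, `|rho * u j - v j| <= B) ->
    `|rho * (\sum_j G i j * u j) - \sum_j G i j * v j| <= B * \sum_j `|G i j|.
  move=> uv; rewrite mulr_sumr -sumrB mulr_sumr.
  apply: le_trans (ler_norm_sum _ _ _) _; apply: ler_sum => j _.
  by rewrite mulrCA -mulrBr normrM mulrC ler_wpM2r.
rewrite /S {S S0} /=.
move: (grads g x) (grads h x) (grad f x) => Gg Gh gf.
case: (split_ordP k) => i ->; exists i.
  rewrite !col_mxEu !mxE.
  have H1 := sumB _ Gg i (fun j => pos_part (g x j 0))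
    (fun j => pos_part (rho * g x j 0 + mult_lam L j 0)) (fun j => posB _ _ (BL j)).
  have H2 : `|rho * (\sum_j Gh i j * h x j 0) -
      \sum_j Gh i j * (rho * h x j 0 + mult_mu L j 0)| <= B * \sum_j `|Gh i j|.
    by apply: sumB => j; rewrite opprD addNKr normrN.
  have H3 : `|mult_gam L i 0 * y i 0| <= B * `|y i 0| by rewrite normrM ler_wpM2r.
  under [\sum_j _ * vpos (g x) j 0]eq_bigr do rewrite mxE.
  under [\sum_j _ * (vpos _) j 0]eq_bigr do rewrite !mxE.
  under [\sum_j _ * (rho *: h x + mult_mu L) j 0]eq_bigr do rewrite !mxE.
  have := ler_norm (gf i 0); have := ler_norm (- gf i 0); rewrite normrN.
  have Bx := mulr_ge0 B0 (normr_ge0 (x i 0)).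
  move: H1 H2 H3; rewrite !ler_norml => /andP[? ?] /andP[? ?] /andP[? ?] ? ?.
  by apply/andP; split; lra.
rewrite !col_mxEd !mxE.
have H1 : `|mult_gam L i 0 * x i 0| <= B * `|x i 0| by rewrite normrM ler_wpM2r.
have H2 := posB (card_gap kappa y) _ BD.
have H3 := posB (y i 0 - 1) _ (BE i).
have := normr_ge0 (gf i 0).
have B1 : 0 <= B * (\sum_j `|Gg i j|) by rewrite mulr_ge0 ?sumr_ge0.
have B2 : 0 <= B * (\sum_j `|Gh i j|) by rewrite mulr_ge0 ?sumr_ge0.
have B3 := mulr_ge0 B0 (normr_ge0 (y i 0)).
move: H1 H2 H3; rewrite !ler_norml => /andP[? ?] /andP[? ?] /andP[? ?] ?.
by apply/andP; split; lra.
Qed.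

End Infeasibility.
End Penalty.



(** * The sequences generated by SALM *)

Section SALM.
Context {R : realType} {n m p : nat}.
Variables (f : 'cV[R]_n -> R) (g : 'cV[R]_n -> 'cV[R]_m) (h : 'cV[R]_n -> 'cV[R]_p)
  (kappa : int).

(** What the rest of the argument retains of a run, along a subsequence. The penalty update rule
    survives only in the positivity of [r] and in [ps_inactive]. *)
Record penalty_sequence (xs ys : 'cV[R]_n) (X Y : nat -> 'cV[R]_n)
    (Lb : nat -> @multipliers R n m p) (r : nat -> R) (B : R) : Prop := {
  ps_x : X @ \oo --> xs;
  ps_y : Y @ \oo --> ys;
  ps_r : forall k, 0 < r k;
  ps_lam_ge0 : forall k j, 0 <= mult_lam (Lb k) j 0;
  ps_lam : forall k j, `|mult_lam (Lb k) j 0| <= B;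
  ps_mu : forall k j, `|mult_mu (Lb k) j 0| <= B;
  ps_gam : forall k j, `|mult_gam (Lb k) j 0| <= B;
  ps_del : forall k, `|mult_del (Lb k)| <= B;
  ps_eta : forall k j, `|mult_eta (Lb k) j 0| <= B;
  ps_grad : forall i,
    (fun k => grad_aug_lagrangian f g h kappa (X k) (Y k) (Lb k) (r k) i 0) @ \oo --> (0 : R);
  ps_inactive : forall i, g xs i 0 < 0 ->
    \forall k \near \oo, r k * g (X k) i 0 + mult_lam (Lb k) i 0 <= 0 }.

Lemma le_enorm N (v : 'cV[R]_N) i : `|v i 0| <= enorm v.
Proof.
rewrite -sqrtr_sqr /enorm ler_sqrt; last by apply: sumr_ge0 => j _; exact: sqr_ge0.
by rewrite /sqnorm (bigD1 i)//= lerDl; apply: sumr_ge0 => j _; exact: sqr_ge0.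
Qed.

Section Run.
Variables (P : @salm_params R) (x y : nat -> 'cV[R]_n)
  (Lbar L : nat -> @multipliers R n m p) (rho : nat -> R).
Hypothesis run : salm_run f g h kappa P x y Lbar L rho.

Let res k := salm_residual g h kappa (x k.+1) (y k.+1) (Lbar k) (rho k).

Lemma salm_rho_gt0_nondecr k : 0 < rho k /\ rho k <= rho k.+1.
Proof.
have s1 := sigma_gt1 (salm_params_ok run).
elim: k => [|k [rk rkS]]; first by rewrite (salm_rho1 run) lexx (salm_rho0 run).
have rk1 : 0 < rho k.+1 by exact: lt_le_trans rkS.
split=> //; rewrite (salm_penalty run); case: ifP => // _.
by rewrite ler_peMl// ltW.
Qed.

Lemma salm_rho_le k l : (k <= l)%N -> rho k <= rho l.
Proof.
move=> /subnK <-; elim: (l - k)%N => [//|j IH].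
by apply: (le_trans IH); have [] := salm_rho_gt0_nondecr (j + k).
Qed.

Lemma salm_residual_ge0 k : 0 <= res k.
Proof. by rewrite /res /salm_residual le_max sqrtr_ge0. Qed.

(** Either the test of the penalty rule eventually always succeeds, and the residual decreases
    geometrically with ratio [1 / tau], or it fails infinitely often, and each failure multiplies
    [rho] by [sigma]. *)
Lemma salm_penalty_dichotomy :
  (forall M, \forall k \near \oo, M <= rho k) \/ res @ \oo --> (0 : R).
Proof.
have s1 := sigma_gt1 (salm_params_ok run).
have t1 := tau_gt1 (salm_params_ok run).
have s0 : 0 < salm_sigma P by exact: lt_trans s1.
have t0 : 0 < salm_tau P by exact: lt_trans t1.
have [[K HK]|often] := pselect (exists K, forall k, (K <= k)%N -> salm_tau P * res k.+1 <= res k).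
  right; have res_le j : res (j + K)%N <= res K * (salm_tau P)^-1 ^+ j.
    elim: j => [|j IH]; first by rewrite expr0 mulr1.
    have := HK (j + K)%N (leq_addl _ _); rewrite -addSn.
    rewrite mulrC -ler_pdivlMr// => H; apply: (le_trans H).
    by rewrite exprSr mulrA ler_wpM2r// invr_ge0 ltW.
  rewrite -(cvg_shiftn K); apply: (squeeze_cvgr (f := fun=> 0)
      (h := fun j => res K * (salm_tau P)^-1 ^+ j)).
  - by near=> j; rewrite salm_residual_ge0 res_le.
  - exact: cvg_cst.
  - rewrite -[X in _ --> X](mulr0 (res K)); apply: cvgMr; apply: cvg_expr.
    by rewrite gtr0_norm ?invr_gt0// invf_lt1.
left => M.
have grow N : exists K, salm_sigma P ^+ N * rho 0%N <= rho K.
  elim: N => [|N [K HK]]; first by exists 0%N; rewrite expr0 mul1r.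
  have [k Kk nk] : exists2 k, (K <= k)%N & ~ (salm_tau P * res k.+1 <= res k).
    apply: contrapT => H; apply: often; exists K => k Kk; apply: contrapT => nk.
    by apply: H; exists k.
  exists k.+2; rewrite (salm_penalty run) ifF; last exact/negP.
  rewrite exprS -mulrA ler_pM2l//; apply: (le_trans HK).
  exact/salm_rho_le/(leq_trans Kk).
have [N HN] : exists N, M / rho 0%N <= salm_sigma P ^+ N.
  pose c := `|M / rho 0%N| + 1.
  have c0 : 0 < c by rewrite ltr_wpDl.
  have : `|(salm_sigma P)^-1| < 1 by rewrite gtr0_norm ?invr_gt0// invf_lt1.
  move=> /cvg_expr/cvgrPdist_lt/(_ c^-1); rewrite invr_gt0 => /(_ c0)[N _ /(_ N (leqnn N))].
  rewrite /= sub0r normrN exprVn gtr0_norm ?invr_gt0 ?exprn_gt0// ltf_pV2 ?posrE ?exprn_gt0//.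
  by move=> cN; exists N; apply: le_trans (ltW cN); rewrite /c; have := ler_norm (M / rho 0%N); lra.
have [K HK] := grow N; exists K => // k /= Kk.
apply: le_trans (salm_rho_le Kk); apply: le_trans HK.
by rewrite -ler_pdivrMr// (salm_rho0 run).
Unshelve. all: by end_near. Qed.

Lemma salm_penalty_sequence xs ys :
  (forall x, differentiable g x) ->
  cluster ((fun k => (x k, y k)) @ \oo) (xs, ys) ->
  exists X Y Lb r B, penalty_sequence xs ys X Y Lb r B.
Proof.
move=> dg clus.
have [Pl1 Pm Pg Pd Pe Pt Ps eps0 epsd epsc] := salm_params_ok run.
pose B := lam_max P + (`|mu_min P| + `|mu_max P|) + (`|gam_min P| + `|gam_max P|)
  + del_max P + eta_max P.
(* The iterate of index [j.+1] is paired with the multipliers and the penalty of index [j] from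
   which it was computed. [k <= phi k] replaces strict monotonicity and suffices for limits. *)
have /choice[phi phiP] : forall k : nat, exists j : nat, (k <= j)%N /\
    `|xs - x j.+1| < k.+1%:R^-1 /\ `|ys - y j.+1| < k.+1%:R^-1.
  move=> k; have k0 : 0 < k.+1%:R^-1 :> R by rewrite invr_gt0.
  have [] := clus [set xy | exists2 j, (k < j)%N & xy = (x j, y j)]
    [set xy | `|xs - xy.1| < k.+1%:R^-1 /\ `|ys - xy.2| < k.+1%:R^-1].
  - by exists k.+1 => // j /= kj; exists j.
  - apply/nbhs_ballP; exists k.+1%:R^-1 => //= -[a b] [/= aB bB].
    by rewrite -ball_normE /= in aB bB.
  move=> xy [[[//|j] kj ->] [/= H1 H2]]; exists j; split=> //.
have phi_ge k : (k <= phi k)%N by have [] := phiP k.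
have phi_oo : phi @ \oo --> \oo.
  by move=> A [N _ NA]; exists N => // k /= Nk; apply: NA; exact: leq_trans (phi_ge k).
have to0 (V : normedModType R) (u : nat -> V) (l : V) :
    (forall k, `|l - u k| < k.+1%:R^-1) -> u @ \oo --> l.
  move=> ul; apply/cvgrPdist_lt => e e0; near=> k.
  apply: lt_trans (ul k) _; near: k.
  by have := near_infty_natSinv_lt (PosNum e0); exact.
have X_cvg : (fun k => x (phi k).+1) @ \oo --> xs by apply: to0 => k; have [_ []] := phiP k.
have Y_cvg : (fun k => y (phi k).+1) @ \oo --> ys by apply: to0 => k; have [_ []] := phiP k.
exists (fun k => x (phi k).+1), (fun k => y (phi k).+1), (fun k => Lbar (phi k)),
  (fun k => rho (phi k)), B.
have absB (a b c : R) : a <= c <= b -> `|c| <= `|a| + `|b|.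
  move=> /andP[ac cb]; rewrite ler_norml; apply/andP; split.
    by have := ler_norm (- a); rewrite normrN; have := normr_ge0 b; lra.
  by have := ler_norm b; have := normr_ge0 a; lra.
have nn := (normr_ge0 (mu_min P), normr_ge0 (mu_max P), normr_ge0 (gam_min P), normr_ge0 (gam_max P)).
have [[[n1 n2] n3] n4] := nn.
split=> //.
- by move=> k; have [] := salm_rho_gt0_nondecr (phi k).
- by move=> k j; have [/(_ j)/andP[]] := salm_box run (phi k).
- move=> k j; have [/(_ j)/andP[l0 l1] _ _ _ _] := salm_box run (phi k).
  by rewrite ger0_norm// /B; lra.
- move=> k j; have [_ /(_ j)/absB H _ _ _] := salm_box run (phi k).
  by apply: (le_trans H); rewrite /B; lra.
- move=> k j; have [_ _ /(_ j)/absB H _ _] := salm_box run (phi k).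
  by apply: (le_trans H); rewrite /B; lra.
- move=> k; have [_ _ _ /andP[l0 l1] _] := salm_box run (phi k).
  by rewrite ger0_norm// /B; lra.
- move=> k j; have [_ _ _ _ /(_ j)/andP[l0 l1]] := salm_box run (phi k).
  by rewrite ger0_norm// /B; lra.
- move=> i; apply/cvgrPdist_le => e e0.
  have epsphi : (fun k => salm_eps P (phi k).+1) @ \oo --> (0 : R).
    have phiS_oo : (fun k => (phi k).+1) @ \oo --> \oo.
      by move=> A [N _ NA]; exists N => // k /= Nk; apply: NA; exact/leqW/(leq_trans Nk).
    exact: (cvg_comp _ (salm_eps P) phiS_oo).
  move/cvgrPdist_le : epsphi => /(_ e e0); apply: filterS => k.
  rewrite !sub0r !normrN ger0_norm// => H; apply: le_trans H.
  exact: le_trans (le_enorm _ i) (salm_approx_stationary run (phi k)).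
- move=> i gi.
  have gX : (fun k => g (x (phi k).+1) i 0) @ \oo --> g xs i 0.
    exact: (cvg_colP _ _).1 (continuous_cvg _ (differentiable_continuous (dg xs)) X_cvg) i.
  have gX2 : \forall k \near \oo, g (x (phi k).+1) i 0 < g xs i 0 / 2.
    by apply: (cvgr_lt (g xs i 0) gX); lra.
  have lam0 k : 0 <= mult_lam (Lbar k) i 0 <= lam_max P.
    by have [/(_ i)] := salm_box run k.
  (* With [g] below half its negative limit, a large [rho] outweighs the bounded safeguarded
     multiplier. Otherwise the minimum in the residual is small; it cannot be [-g], so the
     multiplier divided by [rho] is, and it lies below [-g]. *)
  have [rho_oo|res0] := salm_penalty_dichotomy.
    have := rho_oo (lam_max P / (- (g xs i 0 / 2))); move=> /phi_oo.
    rewrite near_simpl /= => big; near=> k.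
    have H1 : g (x (phi k).+1) i 0 < g xs i 0 / 2 by near: k.
    have : lam_max P / (- (g xs i 0 / 2)) <= rho (phi k) by near: k.
    rewrite ler_pdivrMr; last lra.
    have /andP[_] := lam0 (phi k); have [r0 _] := salm_rho_gt0_nondecr (phi k).
    have := ltr_pM2l r0 (g (x (phi k).+1) i 0) (g xs i 0 / 2); rewrite H1.
    lra.
  have : (fun k => res (phi k)) @ \oo --> (0 : R) by exact: (cvg_comp phi res phi_oo res0).
  have e0 : 0 < - (g xs i 0 / 2) by lra.
  move=> /cvgrPdist_lt/(_ _ e0) small; near=> k.
  have H1 : g (x (phi k).+1) i 0 < g xs i 0 / 2 by near: k.
  have : `|0 - res (phi k)| < - (g xs i 0 / 2) by near: k.
  rewrite sub0r normrN ger0_norm ?salm_residual_ge0// => Hres.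
  have [r0 _] := salm_rho_gt0_nondecr (phi k).
  have : Num.min (- g (x (phi k).+1) i 0) ((rho (phi k))^-1 * mult_lam (Lbar (phi k)) i 0)
      < - (g xs i 0 / 2).
    apply: le_lt_trans Hres; rewrite /res /salm_residual le_max; apply/orP; left.
    apply: le_trans (le_enorm _ i); rewrite !mxE; exact: ler_norm.
  rewrite gt_min => /orP[|]; first lra.
  move=> H2; have H3 : (rho (phi k))^-1 * mult_lam (Lbar (phi k)) i 0 < - g (x (phi k).+1) i 0 by lra.
  move: H3; rewrite mulrC ltr_pdivrMr//; lra.
Unshelve. all: by end_near. Qed.

End Run.
End SALM.



(** * Bounded multipliers *)

Section BoundedMultipliers.
Context {R : realType}.

(* As long as the columns of the support are dependent, the smallest multiple of
   a dependency that cancels a coefficient can be subtracted without changing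
   the sign of any other coefficient. *)
Lemma caratheodory n q (J : 'M[R]_(n, q)) (nu : 'cV[R]_q) :
  exists nu' : 'cV[R]_q, [/\ J *m nu' = J *m nu,
    forall i, nu i 0 = 0 -> nu' i 0 = 0,
    forall i, 0 <= nu i 0 -> 0 <= nu' i 0 &
    forall beta : 'cV[R]_q, J *m beta = 0 ->
      (forall i, nu' i 0 = 0 -> beta i 0 = 0) -> beta = 0].
Proof.
have [N] := ubnP #|[set i | nu i 0 != 0]%SET|; elim: N nu => // N IH nu card_nu.
have [indep|] := pselect (forall beta : 'cV[R]_q, J *m beta = 0 ->
  (forall i, nu i 0 = 0 -> beta i 0 = 0) -> beta = 0); first by exists nu.
move=> /existsNP[beta /not_implyP[Jb /not_implyP[supp nz]]].
have [i0 bi0] : exists i, beta i 0 != 0.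
  apply: contrapT => H; apply: nz; apply/matrixP => i j; rewrite ord1 mxE.
  by apply/eqP/negPn/negP => bi; apply: H; exists i.
pose ratio i : R := `|nu i 0 / beta i 0|.
have [i bi mini] : exists2 i, beta i 0 != 0 & forall j, beta j 0 != 0 -> ratio i <= ratio j.
  by case: (@arg_minP _ _ _ i0 (fun i => beta i 0 != 0) ratio bi0) => i bi mini; exists i.
pose t := nu i 0 / beta i 0.
pose nu1 : 'cV[R]_q := nu - t *: beta.
have nu1E j : nu1 j 0 = nu j 0 - t * beta j 0 by rewrite !mxE.
have tb j : `|t * beta j 0| <= `|nu j 0|.
  have [->|bj] := eqVneq (beta j 0) 0; first by rewrite mulr0 normr0.
  have := mini j bj; rewrite /ratio -/t [leRHS]normrM normfV ler_pdivlMr ?normr_gt0//.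
  by rewrite (normrM t).
have [|nu' [Jnu' supp' sign' indep']] := IH nu1.
- rewrite ltnS in card_nu; apply: leq_trans card_nu; apply: proper_card; apply/fintype.properP; split.
    apply/fintype.subsetP => j; rewrite !inE nu1E; apply: contra => /eqP nuj.
    by rewrite nuj supp// mulr0 subrr.
  exists i; rewrite !inE; first by apply: contra bi => /eqP/supp ->.
  by rewrite negbK nu1E /t divfK// subrr.
exists nu'; split=> // [|j nuj|j nuj].
- by rewrite Jnu' /nu1 mulmxBr -scalemxAr Jb scaler0 subr0.
- by apply: supp'; rewrite nu1E nuj supp// mulr0 subrr.
- by apply: sign'; rewrite nu1E; have := tb j; rewrite [`|nu j 0|]ger0_norm// ler_norml; lra.
Qed.

(** Independence of the columns in [S] says that [J *m D], with [D] the projection onto [S], has the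
    same kernel as [D]. Hence [D = X *m (J *m D)] for some [X], and transposing gives the solution
    [X^T *m s]. *)
Lemma independent_columns_direction n q (J : 'M[R]_(n, q)) (S : pred 'I_q) (s : 'cV[R]_q) :
  (forall beta : 'cV[R]_q, J *m beta = 0 -> (forall i, ~~ S i -> beta i 0 = 0) -> beta = 0) ->
  exists d : 'cV[R]_n, forall i, S i -> (J^T *m d) i 0 = s i 0.
Proof.
move=> indep; pose D : 'M[R]_q := diag_mx (\row_i (S i)%:R).
have DE (r : nat) (A : 'M[R]_(q, r)) i j : (D *m A) i j = (S i)%:R * A i j.
  by rewrite mul_diag_mx !mxE.
have : (D <= J *m D)%MS.
  rewrite submxE; apply/eqP/matrixP => i j.
  have : col j (D *m cokermx (J *m D)) = 0.
    apply: indep => [|k Sk].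
      by rewrite colE (mulmxA J) (mulmxA J D) mulmx_coker mul0mx.
    by rewrite mxE DE (negPf Sk) mul0r.
  by move=> /matrixP/(_ i 0); rewrite !mxE.
move=> /submxP[X DX]; exists (X^T *m s) => i Si.
have Dt : D^T = D by rewrite /D tr_diag_mx.
have : D *m (J^T *m (X^T *m s)) = D *m s.
  rewrite !mulmxA -[X in X *m J^T]Dt -trmx_mul -trmx_mul -DX.
  by rewrite Dt.
by move=> /matrixP/(_ i 0); rewrite !DE Si !mul1r.
Qed.

Lemma is_grad_ray N (F : 'cV[R]_N -> R) xs a (d : 'cV[R]_N) s :
  is_grad F xs a -> F xs = 0 -> \sum_i a i 0 * d i 0 = s -> s != 0 ->
  \forall k \near \oo, 0 < s * F (xs + k.+1%:R^-1 *: d).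
Proof.
move=> Fa F0 ds s0; pose D := \sum_i `|d i 0| + 1.
have D0 : 0 < D by rewrite ltr_wpDl ?sumr_ge0.
(* With this tolerance the error along the ray is at most half of the linear term [t * s], which
   thus determines the sign. *)
have e0 : 0 < `|s| / (2 * D) by rewrite divr_gt0 ?normr_gt0// mulr_gt0.
have [r r0 Hr] := Fa _ e0.
have rD : 0 < r / D by rewrite divr_gt0.
near=> k.
have tr : k.+1%:R^-1 < r / D by near: k; have := near_infty_natSinv_lt (PosNum rD); exact.
have t0 : 0 < k.+1%:R^-1 :> R by rewrite invr_gt0.
move: (k.+1%:R^-1) t0 tr => t t0 tr.
have wE i : (xs + t *: d) i 0 - xs i 0 = t * d i 0 by rewrite !mxE addrC addKr.
have := Hr (xs + t *: d); rewrite F0 subr0.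
under eq_bigr do rewrite wE mulrCA.
under [X in _ -> _ <= _ * X]eq_bigr do rewrite wE normrM (gtr0_norm t0).
rewrite -!mulr_sumr ds => H.
have {}H : `|F (xs + t *: d) - t * s| <= `|s| / (2 * D) * (t * \sum_i `|d i 0|).
  apply: H => i; rewrite wE normrM (gtr0_norm t0).
  apply: (@le_lt_trans _ _ (t * D)); last by rewrite -ltr_pdivlMr.
  rewrite ler_pM2l// /D (bigD1 i)//= -addrA lerDl addr_ge0// sumr_ge0//.
have H2 : `|s| / (2 * D) * (t * \sum_i `|d i 0|) <= `|s| * t / 2.
  have -> : `|s| * t / 2 = `|s| / (2 * D) * (t * D) by field; exact: lt0r_neq0.
  by rewrite ler_pM2l// ler_pM2l// lerDl.
have := le_trans H H2 => {H2}H2.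
have s2 : 0 < `|s| by rewrite normr_gt0.
have st := mulr_gt0 s2 t0.
have [sp|sn|/eqP] := ltgtP 0 s; last by rewrite eq_sym (negPf s0).
  rewrite (gtr0_norm sp) in H2 st; rewrite mulr_gt0//.
  by move: H2; rewrite ler_norml => /andP[]; lra.
rewrite (ltr0_norm sn) in H2 st; rewrite nmulr_rgt0//.
by move: H2; rewrite ler_norml => /andP[]; lra.
Unshelve. all: by end_near. Qed.

Lemma harmonic_ray_cvg N (xs d : 'cV[R]_N) :
  (fun k => xs + k.+1%:R^-1 *: d) @ \oo --> xs.
Proof.
apply/cvg_colP => i; under eq_fun do rewrite !mxE.
have : (fun k => xs i 0 + k.+1%:R^-1 * d i 0) @ \oo --> xs i 0 + 0 * d i 0.
  by apply: cvgD; [exact: cvg_cst|apply: cvgMl; exact: cvg_harmonic].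
by rewrite mul0r addr0.
Qed.

Lemma cvgn_sum (I : finType) (u : I -> nat -> R) (l : I -> R) :
  (forall i, u i @ \oo --> l i) -> (fun k => \sum_i u i k) @ \oo --> \sum_i l i.
Proof.
move=> ul; elim: (index_enum I) => [|i r IH].
  by under eq_fun do rewrite big_nil; rewrite big_nil; exact: cvg_cst.
by under eq_fun do rewrite big_cons; rewrite big_cons; exact: cvgD.
Qed.

Section PairNorm.
Context {m p n : nat}.
Variables (lam : 'cV[R]_m) (mu : 'cV[R]_p) (gam : 'cV[R]_n).
Let pi := `|(1 : R, lam, mu, gam)|.

Lemma multiplier_norm_bounds : [/\ 1 <= pi, forall i, `|lam i 0| <= pi,
  forall i, `|mu i 0| <= pi & forall i, `|gam i 0| <= pi].
Proof.
rewrite /pi !prod_normE /= normr1; split=> [|i|i|i]; rewrite !le_max ?lexx//.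
- by rewrite le_mx_norm !orbT.
- by rewrite le_mx_norm !orbT.
- by rewrite le_mx_norm !orbT.
Qed.

Lemma multiplier_norm_gt0 : 0 < pi.
Proof. by have [pi1 _ _ _] := multiplier_norm_bounds; exact: lt_le_trans pi1. Qed.

End PairNorm.

Section Stationary.
Context {n m p : nat}.
Variables (f : 'cV[R]_n -> R) (g : 'cV[R]_n -> 'cV[R]_m) (h : 'cV[R]_n -> 'cV[R]_p).
Hypotheses (fC1 : continuously_differentiable f) (gC1 : continuously_differentiable g)
  (hC1 : continuously_differentiable h).

Lemma stationarity_cvg xs (x : nat -> 'cV[R]_n) lam0 mu0 gam0
    (lam : nat -> 'cV[R]_m) (mu : nat -> 'cV[R]_p) (gam : nat -> 'cV[R]_n) :
  x @ \oo --> xs -> lam @ \oo --> lam0 -> mu @ \oo --> mu0 -> gam @ \oo --> gam0 ->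
  (fun k => grad f (x k) + grads g (x k) *m lam k + grads h (x k) *m mu k + gam k) @ \oo -->
   grad f xs + grads g xs *m lam0 + grads h xs *m mu0 + gam0.
Proof.
move=> xxs /cvg_colP ll /cvg_colP mm gg; apply: cvgD => //; apply: cvgD; first apply: cvgD.
- exact: C1_grad_cvg.
- apply/cvg_colP => i; rewrite mxE; under eq_fun do rewrite mxE.
  by apply: cvgn_sum => j; apply: cvgM => //; exact: C1_row_cvg.
- apply/cvg_colP => i; rewrite mxE; under eq_fun do rewrite mxE.
  by apply: cvgn_sum => j; apply: cvgM => //; exact: C1_row_cvg.
Qed.

(** With constant multipliers the normalized limits are nonzero exactly on the support, and
    stationarity holds in the limit by continuity of the gradients; only the signs along the ray are
    left to arrange. *)
Lemma kkt_cc_pam_sequence (xs : 'cV[R]_n) (lam : 'cV[R]_m) (mu : 'cV[R]_p) (gam : 'cV[R]_n) :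
  (forall i, 0 <= lam i 0) -> (forall i, g xs i 0 != 0 -> lam i 0 = 0) -> h xs = 0 ->
  (forall i, xs i 0 != 0 -> gam i 0 = 0) ->
  grad f xs + grads g xs *m lam + grads h xs *m mu + gam = 0 ->
  exists x lam mu gam, cc_pam_sequence f g h xs x lam mu gam.
Proof.
move=> lam0 lam_in hxs gam_in kkt.
(* The identity columns are the gradients of the coordinates, so that [gam] is treated as the
   multiplier of the constraints [x_i = 0]. *)
pose J := row_mx (row_mx (grads g xs) (grads h xs)) (1%:M : 'M[R]_n).
have JE l u v : J *m col_mx (col_mx l u) v = grads g xs *m l + grads h xs *m u + v.
  by rewrite !mul_row_col mul1mx.
have [nu [Jnu supp sign indep]] := caratheodory J (col_mx (col_mx lam mu) gam).
pose s : 'cV[R]_(m + p + n) := \col_i Num.sg (nu i 0).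
have [d dP] : exists d : 'cV[R]_n, forall i, nu i 0 != 0 -> (J^T *m d) i 0 = s i 0.
  apply: (independent_columns_direction (S := fun i => nu i 0 != 0)) => beta Jb supp0.
  by apply: indep => // i /eqP nui; apply: supp0; rewrite negbK.
pose lam' := usubmx (usubmx nu); pose mu' := dsubmx (usubmx nu); pose gam' := dsubmx nu.
have nuE : nu = col_mx (col_mx lam' mu') gam' by rewrite !vsubmxK.
have lamE i : nu (lshift n (lshift p i)) 0 = lam' i 0 by rewrite !mxE.
have muE i : nu (lshift n (rshift m i)) 0 = mu' i 0 by rewrite !mxE.
have gamE i : nu (rshift (m + p) i) 0 = gam' i 0 by rewrite !mxE.
pose x k := xs + k.+1%:R^-1 *: d.
pose c := `|(1 : R, lam', mu', gam')|.
have c0 : 0 < c by exact: multiplier_norm_gt0.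
have sg_pos (a b : R) : a != 0 -> 0 < Num.sg a * b -> 0 < a * b.
  by move=> a0 ab; rewrite [X in X * b]numEsg mulrAC mulr_gt0// normr_gt0.
have lam_act i : lam' i 0 != 0 -> g xs i 0 = 0.
  move=> lami; apply/eqP/negPn/negP => /lam_in gi; move/negP : lami; apply.
  by rewrite -lamE supp// col_mxEu col_mxEu gi.
have gam_act i : gam' i 0 != 0 -> xs i 0 = 0.
  move=> gami; apply/eqP/negPn/negP => /gam_in gi; move/negP : gami; apply.
  by rewrite -gamE supp// col_mxEd gi.
have lam_d i : lam' i 0 != 0 -> \sum_a grad (fun z => g z i 0) xs a 0 * d a 0 = Num.sg (lam' i 0).
  rewrite -lamE => /dP; rewrite [s _ _]mxE => <-; rewrite mxE; apply: eq_bigr => a _.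
  by rewrite [J^T _ _]mxE row_mxEl row_mxEl [grads _ _ _ _]mxE.
have mu_d i : mu' i 0 != 0 -> \sum_a grad (fun z => h z i 0) xs a 0 * d a 0 = Num.sg (mu' i 0).
  rewrite -muE => /dP; rewrite [s _ _]mxE => <-; rewrite mxE; apply: eq_bigr => a _.
  by rewrite [J^T _ _]mxE row_mxEl row_mxEr [grads _ _ _ _]mxE.
have gam_d i : gam' i 0 != 0 -> \sum_a (delta_mx i 0 : 'cV[R]_n) a 0 * d a 0 = Num.sg (gam' i 0).
  rewrite -gamE => /dP; rewrite [s _ _]mxE => <-; rewrite mxE; apply: eq_bigr => a _.
  by rewrite [J^T _ _]mxE row_mxEr !mxE eqxx andbT.
exists x, (fun=> lam'), (fun=> mu'), (fun=> gam'); split=> //=.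
- by move=> _ i; rewrite -lamE; apply: sign; rewrite col_mxEu col_mxEu.
- exact: harmonic_ray_cvg.
- have <- : grad f xs + grads g xs *m lam' + grads h xs *m mu' + gam' = 0.
    by rewrite -kkt -!addrA; congr (_ + _); rewrite !addrA -!JE -nuE.
  apply: (@stationarity_cvg xs x lam' mu' gam' (fun=> lam') (fun=> mu') (fun=> gam')).
  + exact: harmonic_ray_cvg.
  + exact: cvg_cst.
  + exact: cvg_cst.
  + exact: cvg_cst.
- move=> i gi; apply: nearW => _; apply/eqP/negPn/negP => /lam_act gi0.
  by rewrite gi0 eqxx in gi.
- move=> i xi; apply: nearW => _; apply/eqP/negPn/negP => /gam_act xi0.
  by rewrite xi0 eqxx in xi.
- exact: is_cvg_cst.
- exact: is_cvg_cst.
- exact: is_cvg_cst.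
- move=> i; rewrite lim_cst// pmulr_lgt0 ?invr_gt0// => lami.
  have lami0 := lt0r_neq0 lami.
  have dG := is_grad_differentiable (differentiable_row i (gC1.1 xs)).
  have := is_grad_ray dG (lam_act i lami0) (lam_d i lami0); rewrite sgr_eq0 => /(_ lami0).
  by apply: filterS => k; exact: sg_pos.
- move=> i; rewrite lim_cst// pmulr_lgt0 ?invr_gt0// normr_gt0 => mui0.
  have dG := is_grad_differentiable (differentiable_row i (hC1.1 xs)).
  have hi : h xs i 0 = 0 by rewrite hxs mxE.
  have := is_grad_ray dG hi (mu_d i mui0); rewrite sgr_eq0 => /(_ mui0).
  by apply: filterS => k; exact: sg_pos.
- move=> i; rewrite lim_cst// pmulr_lgt0 ?invr_gt0// normr_gt0 => gami0.
  have := is_grad_ray (is_grad_coord xs i) (gam_act i gami0) (gam_d i gami0).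
  rewrite sgr_eq0 => /(_ gami0).
  by apply: filterS => k; exact: sg_pos.
Qed.

End Stationary.
End BoundedMultipliers.



(** * Sign conditions *)

Section Assembly.
Context {R : realType}.

Lemma subsequence_cvg (theta : nat -> nat) : (forall k, (k <= theta k)%N) ->
  theta @ \oo --> \oo.
Proof.
by move=> tk A [N _ NA]; exists N => // k /= Nk; apply: NA; exact: leq_trans (tk k).
Qed.

Lemma bolzano_weierstrass_family (I : finType) (u : nat -> I -> R) M :
  (forall k i, `|u k i| <= M) ->
  exists theta : nat -> nat, (forall k, (k <= theta k)%N) /\
    forall i, cvgn (fun k => u (theta k) i).
Proof.
move=> uM; suff [theta [tk Ht]] : exists theta : nat -> nat, (forall k, (k <= theta k)%N) /\
    forall i, i \in enum I -> cvgn (fun k => u (theta k) i).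
  by exists theta; split=> // i; apply: Ht; rewrite mem_enum.
elim: (enum I) => [|i r [theta [tk Ht]]]; first by exists id.
have [|f incf cf] := @bolzano_weierstrass R (fun k => u (theta k) i).
  exists M; split; first exact: num_real.
  by move=> x Mx k _ /=; apply: le_trans (uM _ _) (ltW Mx).
have fk k : (k <= f k)%N.
  elim: k => [//|k IH]; apply: (leq_ltn_trans IH).
  by have /increasing_seqP := incf; apply.
exists (theta \o f); split=> [k|j]; first exact: leq_trans (fk k) (tk _).
rewrite inE => /predU1P[->//|/Ht cj].
by apply/cvg_ex; case/cvg_ex: cj => l cl; exists l; exact: (cvg_comp f _ (subsequence_cvg fk) cl).
Qed.

(** This turns a positive normalized limit into a multiplier that exceeds the bound on its
    safeguarded part. *)
Lemma ratio_eventually_large (v w : nat -> R) : cvgn (fun k => v k / w k) ->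
  0 < limn (fun k => v k / w k) -> (forall M, \forall k \near \oo, M < w k) ->
  forall B, \forall k \near \oo, B < v k.
Proof.
move=> cvw; set l := limn _ => l0 w_oo B.
have vl : \forall k \near \oo, l / 2 < v k / w k by apply: (cvgr_gt l cvw); lra.
have w0 := w_oo 0; have wB := w_oo (`|B| / (l / 2)).
near=> k.
have wk : 0 < w k by near: k.
have : l / 2 < v k / w k by near: k.
rewrite ltr_pdivlMr// => H; apply: le_lt_trans H.
have : `|B| / (l / 2) < w k by near: k.
rewrite ltr_pdivrMr ?divr_gt0// => /ltW H; have := ler_norm B; lra.
Unshelve. all: by end_near. Qed.

Lemma cvgn_col N (v : nat -> 'cV[R]_N) :
  (forall i, cvgn (fun k => v k i 0)) -> cvgn v.
Proof.
move=> cv; apply/cvg_ex; exists (\col_i limn (fun k => v k i 0)).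
by apply/cvg_colP => i; rewrite mxE; exact: cv.
Qed.

Context {n m p : nat}.
Variables (f : 'cV[R]_n -> R) (g : 'cV[R]_n -> 'cV[R]_m) (h : 'cV[R]_n -> 'cV[R]_p)
  (kappa : int).
Hypotheses (fC1 : continuously_differentiable f) (gC1 : continuously_differentiable g)
  (hC1 : continuously_differentiable h) (gsa : semialgebraic g) (hsa : semialgebraic h).
Variables (xs ys : 'cV[R]_n) (X Y : nat -> 'cV[R]_n)
  (Lb : nat -> @multipliers R n m p) (r : nat -> R) (B : R).
Hypotheses (feas : relaxation_feasible g h kappa xs ys)
  (ps : penalty_sequence f g h kappa xs ys X Y Lb r B).

(** On the support of [xs] the entries of [ys] vanish and elsewhere they are at most 1, so their sum
    is at most [n - l0norm xs], whereas the gap constraint makes it at least [n - kappa]. *)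
Lemma relaxation_feasible_ccop : ccop_feasible g h kappa xs.
Proof.
have [gx hx xy gap yx] := feas; split=> //.
have y0 i : xs i 0 != 0 -> ys i 0 = 0.
  move=> xi; have /matrixP/(_ i 0) := xy; rewrite !mxE => /eqP.
  by rewrite mulf_eq0 (negPf xi) => /eqP.
have sumy : \sum_i ys i 0 <= \sum_(i < n) (1 - (xs i 0 != 0)%:R).
  apply: ler_sum => i _; case: (eqVneq (xs i 0) 0) => [_|/y0 ->].
    by rewrite subr0.
  by rewrite subrr.
have cardE : \sum_(i < n) (1 - (xs i 0 != 0)%:R) = n%:R - (l0norm xs)%:R :> R.
  rewrite sumrB sumr_const card_ord; congr (_ - _).
  rewrite /l0norm -sum1_card natr_sum [RHS]big_mkcond; apply: eq_bigr => i _.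
  by rewrite inE; case: (_ != _).
rewrite -(ler_int R) -pmulrn; move: gap; rewrite /card_gap; lra.
Qed.

Let U k := multiplier_update g h kappa (X k) (Y k) (Lb k) (r k).

(** The right-hand side of [infeasibility_grad_bound] converges along the sequence, which supplies
    the constant of [penalty_vanishes]; the squared product is at most twice the infeasibility. *)
Lemma scaled_complementarity_cvg0 i :
  (fun k => r k * (X k i 0 * Y k i 0) ^+ 2) @ \oo --> (0 : R).
Proof.
have dg x : differentiable g x := gC1.1 x.
have dh x : differentiable h x := hC1.1 x.
pose S (x y : 'cV[R]_n) : R := \sum_i (`|grad f x i 0| +
   B * (\sum_j `|grads g x i j| + \sum_j `|grads h x i j|
   + `|x i 0| + `|y i 0| + 2)).
have [xX yY] := (ps_x ps, ps_y ps).
have S_cvg : (fun k => S (X k) (Y k)) @ \oo --> S xs ys.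
  apply: cvgn_sum => j; apply: cvgD.
    by apply: cvg_norm; exact: (cvg_colP _ _).1 (C1_grad_cvg fC1 xX) j.
  apply: cvgMr; apply: cvgD; last exact: cvg_cst.
  apply: cvgD; last by apply: cvg_norm; exact: (cvg_colP _ _).1 yY j.
  apply: cvgD; last by apply: cvg_norm; exact: (cvg_colP _ _).1 xX j.
  by apply: cvgD; apply: cvgn_sum => l; apply: cvg_norm; exact: C1_row_cvg.
have bound : \forall k \near \oo, forall l,
    `|r k * infeasibility_grad g h kappa (col_mx (X k) (Y k)) l 0| <= 1 + (S xs ys + 1).
  have H1 : \forall k \near \oo, S (X k) (Y k) <= S xs ys + 1.
    by apply: (cvgr_le _ S_cvg); rewrite ltrDl.
  have H2 : \forall k \near \oo, forall l,
      `|grad_aug_lagrangian f g h kappa (X k) (Y k) (Lb k) (r k) l 0| <= 1.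
    apply: filter_forall => l; have /cvgrPdist_le/(_ 1 ltr01) := ps_grad ps l.
    by apply: filterS => k; rewrite sub0r normrN.
  near=> k; move=> l; apply: (le_trans (@infeasibility_grad_bound _ _ _ _ g h kappa f
    (X k) (Y k) (Lb k) (r k) B l (ps_r ps k) (fC1.1 _) (dg _) (dh _) (ps_lam ps k)
    (ps_mu ps k) (ps_gam ps k) (ps_del ps k) (ps_eta ps k))).
  by apply: lerD; [move: l; near: k|near: k].
apply/cvgrPdist_lt => e e0.
have z_cvg l : (fun k => col_mx (X k) (Y k) l 0) @ \oo --> col_mx xs ys l 0.
  case: (split_ordP l) => l' ->.
    by rewrite col_mxEu; under eq_fun do rewrite col_mxEu; exact: (cvg_colP _ _).1 xX l'.
  by rewrite col_mxEd; under eq_fun do rewrite col_mxEd; exact: (cvg_colP _ _).1 yY l'.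
have e2 : 0 < e / 2 by lra.
have := penalty_vanishes (infeasibility_definable kappa gsa hsa)
  (fun w => infeasibility_is_grad kappa w dg dh) (infeasibility_eq0 feas)
  (infeasibility_ge0 g h kappa) z_cvg (ps_r ps) bound e2.
apply: filterS => k H; rewrite sub0r normrN ger0_norm; last first.
  by rewrite mulr_ge0 ?sqr_ge0// ltW// (ps_r ps).
apply: (@le_lt_trans _ _ (r k * (2 * infeasibility g h kappa (col_mx (X k) (Y k))))); last lra.
by rewrite ler_pM2l ?(ps_r ps)//; exact: complementarity_le_infeasibility.
Unshelve. all: by end_near. Qed.

Let lam k := mult_lam (U k).
Let mu k := mult_mu (U k).
Let gam k : 'cV[R]_n := \col_i if xs i 0 == 0 then mult_gam (U k) i 0 * Y k i 0 else 0.

Lemma support_multiplier_cvg0 i : xs i 0 != 0 ->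
  (fun k => mult_gam (U k) i 0 * Y k i 0) @ \oo --> (0 : R).
Proof.
move=> xi; have [_ _ /matrixP/(_ i 0) xy _ _] := feas.
(* Hence [Y k i 0] tends to 0, which removes the bounded safeguarded part of the product. *)
have yi : ys i 0 = 0 by move: xy; rewrite !mxE => /eqP; rewrite mulf_eq0 (negPf xi) => /eqP.
have Xi := (cvg_colP _ _).1 (ps_x ps) i; have Yi := (cvg_colP _ _).1 (ps_y ps) i.
have Xn0 : \forall k \near \oo, X k i 0 != 0 by exact: (cvgr_neq0 _ Xi xi).
have H : (fun k => r k * (X k i 0 * Y k i 0) ^+ 2 * (X k i 0)^-1 +
    mult_gam (Lb k) i 0 * Y k i 0) @ \oo --> 0 * (xs i 0)^-1 + 0.
  apply: cvgD.
    by apply: cvgM; [exact: scaled_complementarity_cvg0|exact: (cvgV xi Xi)].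
  apply/cvgrPdist_le => e e0.
  have Be : 0 < e / (`|B| + 1) by rewrite divr_gt0// ltr_wpDl.
  have /cvgrPdist_le/(_ _ Be) := Yi; rewrite yi; apply: filterS => k.
  rewrite !sub0r !normrN normrM ler_pdivlMr ?ltr_wpDl// => H; apply: le_trans H.
  rewrite mulrC ler_wpM2l//; apply: le_trans (ps_gam ps k i) _.
  by have := ler_norm B; lra.
rewrite mul0r addr0 in H; apply: cvg_trans H; apply: near_eq_cvg.
apply: filterS Xn0 => k Xk; rewrite /U /= !mxE; field; exact: Xk.
Qed.

Lemma penalty_stationarity :
  (fun k => grad f (X k) + grads g (X k) *m lam k + grads h (X k) *m mu k + gam k)
    @ \oo --> (0 : 'cV[R]_n).
Proof.
apply/cvg_colP => i; rewrite mxE.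
have H : (fun k => grad_aug_lagrangian f g h kappa (X k) (Y k) (Lb k) (r k) (lshift n i) 0 -
    (if xs i 0 == 0 then 0 else mult_gam (U k) i 0 * Y k i 0)) @ \oo --> 0 - (0 : R).
  apply: cvgB; first exact: (ps_grad ps).
  by case: eqVneq => [_|/support_multiplier_cvg0//]; exact: cvg_cst.
rewrite subrr in H; apply: cvg_trans H; apply: near_eq_cvg; apply: nearW => k.
rewrite grad_aug_lagrangianE; [|exact: (ps_r ps)|exact: fC1.1|exact: gC1.1|exact: hC1.1].
have addE (a b : 'cV[R]_n) : (a + b) i 0 = a i 0 + b i 0 by rewrite mxE.
rewrite col_mxEu -/(U k) (addE _ (hadamard _ _)) (addE _ (gam k)).
rewrite [gam k i 0]mxE [hadamard _ _ _ _]mxE.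
by case: eqP => _; rewrite ?subr0 ?addrK ?addr0.
Qed.

Lemma lam_ge0 k i : 0 <= lam k i 0.
Proof. by rewrite /lam /U /= mxE /pos_part le_max lexx orbT. Qed.

Lemma lam_inactive i : g xs i 0 != 0 -> \forall k \near \oo, lam k i 0 = 0.
Proof.
move=> gi; have [gx _ _ _ _] := feas.
have : g xs i 0 < 0 by rewrite lt_neqAle gi gx.
move=> /(ps_inactive ps); apply: filterS => k H.
by rewrite /lam /U /= !mxE /pos_part max_r.
Qed.

Lemma gam_support k i : xs i 0 != 0 -> gam k i 0 = 0.
Proof. by move=> /negPf xi; rewrite mxE xi. Qed.

Lemma lam_sign k i : B < lam k i 0 -> 0 < lam k i 0 * g (X k) i 0.
Proof.
move=> lamB; have LB := le_trans (ler_norm _) (ps_lam ps k i).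
have B0 : 0 <= B by exact: le_trans (normr_ge0 _) (ps_lam ps k i).
have lam0 : 0 < lam k i 0 by exact: le_lt_trans lamB.
rewrite mulr_gt0// -(pmulr_rgt0 _ (ps_r ps k)).
move: lamB; rewrite /lam /U /= !mxE /pos_part lt_max => /orP[|]; lra.
Qed.

(** A sum larger in absolute value than [B] cannot owe its sign to a term of size at most [B]. *)
Lemma large_sign (a b l : R) : `|l| <= B -> B < `|a + l| -> 0 < (a + l) * a.
Proof.
move=> lB; rewrite ler_norml in lB; have /andP[l1 l2] := lB.
have [al|al] := ltrP 0 (a + l).
  by rewrite gtr0_norm// => ?; rewrite mulr_gt0//; lra.
rewrite ler0_norm// => ?; have al0 : a + l < 0 by lra.
by rewrite nmulr_rgt0//; lra.
Qed.

Lemma mu_sign k j : B < `|mu k j 0| -> 0 < mu k j 0 * h (X k) j 0.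
Proof.
rewrite /mu /U /= !mxE => H; rewrite -(pmulr_rgt0 _ (ps_r ps k)) mulrCA.
exact: large_sign (ps_mu ps k j) H.
Qed.

(** The factor [Y] scales the threshold by [M]. It also pairs with [X], so that the sign is that of
    the updated [gamma] times the product [X Y] which it penalizes. *)
Lemma gam_sign k i M : `|Y k i 0| <= M -> B * M < `|gam k i 0| -> 0 < gam k i 0 * X k i 0.
Proof.
rewrite mxE => YM; case: ifP => _; last first.
  rewrite normr0 => H; exfalso; have := le_trans (normr_ge0 _) YM.
  have := le_trans (normr_ge0 _) (ps_gam ps k i); nra.
rewrite /U /= !mxE normrM => H.
have B0 := le_trans (normr_ge0 _) (ps_gam ps k i).
have := large_sign (a := r k * (X k i 0 * Y k i 0)) 0 (ps_gam ps k i).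
move=> /(_ _)/wrap[].
  rewrite ltNge; apply/negP => H1; move: H; apply/negP; rewrite -leNgt.
  by apply: ler_pM.
rewrite mulrCA (pmulr_rgt0 _ (ps_r ps k)); lra.
Qed.

Let pi k := `|(1 : R, lam k, mu k, gam k)|.

Lemma unbounded_cc_pam_sequence : (forall M, \forall k \near \oo, M < pi k) ->
  exists x lam mu gam, cc_pam_sequence f g h xs x lam mu gam.
Proof.
move=> pi_oo.
have pi0 k : 0 < pi k by exact: multiplier_norm_gt0.
have pi_lam k i : `|lam k i 0| <= pi k.
  by have [_ H _ _] := multiplier_norm_bounds (lam k) (mu k) (gam k); exact: H.
have pi_mu k i : `|mu k i 0| <= pi k.
  by have [_ _ H _] := multiplier_norm_bounds (lam k) (mu k) (gam k); exact: H.
have pi_gam k i : `|gam k i 0| <= pi k.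
  by have [_ _ _ H] := multiplier_norm_bounds (lam k) (mu k) (gam k); exact: H.
pose u k (i : 'I_m + 'I_p + 'I_n) := (match i with
  | inl (inl j) => lam k j 0 | inl (inr j) => mu k j 0 | inr j => gam k j 0 end) / pi k.
have u1 k i : `|u k i| <= 1.
  rewrite normrM normfV (gtr0_norm (pi0 k)) ler_pdivrMr// mul1r.
  by case: i => [[]|] j.
have [theta [tk cu]] := bolzano_weierstrass_family u1.
have t_oo := subsequence_cvg tk.
have pit_oo M : \forall k \near \oo, M < pi (theta k) by exact: t_oo (pi_oo M).
have Yt i := cvg_comp theta (fun k => Y k i 0) t_oo ((cvg_colP _ _).1 (ps_y ps) i).
have Xt := cvg_comp theta X t_oo (ps_x ps).
have St := cvg_comp theta _ t_oo penalty_stationarity.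
exists (X \o theta), (lam \o theta), (mu \o theta), (gam \o theta); split=> /=.
- by move=> k i; exact: lam_ge0.
- exact: Xt.
- exact: St.
- by move=> i /lam_inactive; exact: t_oo.
- by move=> i xi; apply: nearW => k; exact: gam_support.
- by apply: cvgn_col => i; under eq_fun do rewrite mxE mulrC; exact: cu (inl (inl i)).
- by apply: cvgn_col => i; under eq_fun do rewrite mxE mulrC; exact: cu (inl (inr i)).
- by apply: cvgn_col => i; under eq_fun do rewrite mxE mulrC; exact: cu (inr i).
- move=> i l0; have := ratio_eventually_large (cu (inl (inl i))) l0 pit_oo B.
  by apply: filterS => k; exact: lam_sign.
- move=> i l0.
  have cmu : cvgn (fun k => `|mu (theta k) i 0| / pi (theta k)).
    have /cvg_ex[l cl] := cu (inl (inr i)); apply/cvg_ex; exists `|l|.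
    have := cvg_norm cl; under eq_fun do rewrite normrM normfV (gtr0_norm (pi0 _)).
    exact.
  have := ratio_eventually_large cmu l0 pit_oo B.
  by apply: filterS => k; exact: mu_sign.
- move=> i l0.
  have cgam : cvgn (fun k => `|gam (theta k) i 0| / pi (theta k)).
    have /cvg_ex[l cl] := cu (inr i); apply/cvg_ex; exists `|l|.
    have := cvg_norm cl; under eq_fun do rewrite normrM normfV (gtr0_norm (pi0 _)).
    exact.
  have YM : \forall k \near \oo, `|Y (theta k) i 0| <= `|ys i 0| + 1.
    by apply: (cvgr_le _ (cvg_norm (Yt i))); rewrite ltrDl.
  have gM := ratio_eventually_large cgam l0 pit_oo (B * (`|ys i 0| + 1)).
  near=> k; apply: (@gam_sign _ _ (`|ys i 0| + 1)); first by near: k.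
  by near: k.
Unshelve. all: by end_near. Qed.

(** The negation of divergence bounds [pi] only on an infinite set of indices; a convergent
    subsequence taken there passes nonnegativity, both support conditions and stationarity to the
    limit. *)
Lemma bounded_cc_pam_sequence M : (forall K, exists2 k, (K <= k)%N & pi k <= M) ->
  exists x lam mu gam, cc_pam_sequence f g h xs x lam mu gam.
Proof.
move=> /(_ _)/cid2-/all_sig2[t0 t0k piM].
pose u k (i : 'I_m + 'I_p + 'I_n) := match i with
  | inl (inl j) => lam (t0 k) j 0 | inl (inr j) => mu (t0 k) j 0 | inr j => gam (t0 k) j 0 end.
have uM k i : `|u k i| <= M.
  apply: le_trans (piM k).
  have [_ H1 H2 H3] := multiplier_norm_bounds (lam (t0 k)) (mu (t0 k)) (gam (t0 k)).
  by case: i => [[]|] j; [exact: H1|exact: H2|exact: H3].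
have [theta [tk cu]] := bolzano_weierstrass_family uM.
have t_oo : t0 \o theta @ \oo --> \oo.
  by apply: subsequence_cvg => k; exact: leq_trans (tk k) (t0k _).
pose lam1 : 'cV[R]_m := \col_i limn (fun k => u (theta k) (inl (inl i))).
pose mu1 : 'cV[R]_p := \col_i limn (fun k => u (theta k) (inl (inr i))).
pose gam1 : 'cV[R]_n := \col_i limn (fun k => u (theta k) (inr i)).
have cl : (lam \o (t0 \o theta)) @ \oo --> lam1.
  by apply/cvg_colP => i; rewrite mxE; exact: cu.
have cm : (mu \o (t0 \o theta)) @ \oo --> mu1.
  by apply/cvg_colP => i; rewrite mxE; exact: cu.
have cg : (gam \o (t0 \o theta)) @ \oo --> gam1.
  by apply/cvg_colP => i; rewrite mxE; exact: cu.
have cX := cvg_comp (t0 \o theta) X t_oo (ps_x ps).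
have c1 := stationarity_cvg fC1 gC1 hC1 cX cl cm cg.
have c2 := cvg_comp (t0 \o theta) _ t_oo penalty_stationarity.
have [_ hx _ _ _] := feas.
apply: (@kkt_cc_pam_sequence _ n m p f g h fC1 gC1 hC1 xs lam1 mu1 gam1) => //.
- move=> i; rewrite mxE; apply: limr_ge; first exact: cu.
  by apply: nearW => k; exact: lam_ge0.
- move=> i gi; have ci := (cvg_colP _ _).1 cl i.
  have ci0 : (fun k => (lam \o (t0 \o theta)) k i 0) @ \oo --> (0 : R).
    by apply: cvg_near_cst; exact: t_oo (lam_inactive gi).
  exact: (cvg_unique _ ci ci0).
- move=> i xi; have ci := (cvg_colP _ _).1 cg i.
  have ci0 : (fun k => (gam \o (t0 \o theta)) k i 0) @ \oo --> (0 : R).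
    by apply: cvg_near_cst; apply: nearW => k; exact: gam_support.
  exact: (cvg_unique _ ci ci0).
- exact: (cvg_unique _ c1 c2).
Qed.

Lemma penalty_sequence_cc_pam : cc_pam_stationary f g h kappa xs.
Proof.
split; first exact: relaxation_feasible_ccop.
have [pi_oo|] := pselect (forall M, \forall k \near \oo, M < pi k).
  exact: unbounded_cc_pam_sequence.
move=> /existsNP[M nM]; apply: (@bounded_cc_pam_sequence M) => K.
apply: contrapT => H; apply: nM; exists K => // k /= Kk.
by rewrite ltNge; apply/negP => kM; apply: H; exists k.
Qed.

End Assembly.

Theorem theorem5p1 (R : realType) (n m p : nat)
    (f : 'cV[R]_n -> R) (g : 'cV[R]_n -> 'cV[R]_m) (h : 'cV[R]_n -> 'cV[R]_p)
    (kappa : int)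
    (kappa_lt_n : kappa < n%:Z)
    (f_C1 : continuously_differentiable f)
    (g_C1 : continuously_differentiable g)
    (h_C1 : continuously_differentiable h)
    (g_semialgebraic : semialgebraic g)
    (h_semialgebraic : semialgebraic h)
    (x y : nat -> 'cV[R]_n) (xs ys : 'cV[R]_n)
    (xy_salm : generated_by_salm f g h kappa x y)
    (xys_accumulation : cluster ((fun k => (x k, y k)) @ \oo) (xs, ys))
    (xys_feasible : relaxation_feasible g h kappa xs ys) :
  cc_pam_stationary f g h kappa xs.
Proof.
have [P [Lbar [L [rho run]]]] := xy_salm.
have [X [Y [Lb [r [B ps]]]]] := salm_penalty_sequence run g_C1.1 xys_accumulation.
exact: penalty_sequence_cc_pam ps.
Qed.
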